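(* There exists a basic sequence $Q=(q_n)_{n\ge1}$ such that the set $$U_Q=\Big\{x=0.E_1E_2\cdots \text{ w.r.t. } Q \;:\; rx+s\in \mathcal{N}(Q)\setminus \mathcal{DN}(Q)\ \text{ for all } r\in\mathbb{Q}\setminus\{0\},\ s\in\mathbb{Q}\Big\}$$ has Hausdorff dimension $1$.
   Context: A basic sequence is a sequence $Q=(q_n)_{n\ge1}$ of integers with $q_n\ge 2$. Every real $x$ has a unique $Q$-Cantor series expansion $x=E_0+\sum_{n\ge1}\frac{E_n}{q_1\cdots q_n}$ with $E_0=\lfloor x\rfloor$, $E_n\in\{0,\dots,q_n-1\}$ and $E_n\ne q_n-1$ infinitely often; $x=0.E_1E_2\cdots$ w.r.t. $Q$ means $E_0=0$, i.e. $x\in[0,1)$. A block of length $k$ is a $k$-tuple of non-negative integers. For a block $B$ of length $k$, $N_n^Q(B,x)$ is the number of indices $i$ with $1\le i\le n$ (and the block fitting inside $E_1,\dots,E_n$) such that $(E_i,\dots,E_{i+k-1})=B$. Let $Q_n^{(k)}=\sum_{j=1}^n \frac{1}{q_jq_{j+1}\cdots q_{j+k-1}}$. A real $x$ is $Q$-normal of order $k$ if $\lim_{n\to\infty} N_n^Q(B,x)/Q_n^{(k)}=1$ for all blocks $B$ of length $k$; $\mathcal{N}(Q)$ is the set of $x$ that are $Q$-normal of order $k$ for every $k\ge1$. Let $T_{Q,n}(x)=(q_1\cdots q_n)x \bmod 1$; $x$ is $Q$-distribution normal if $(T_{Q,n}(x))_{n\ge0}$ is uniformly distributed mod $1$, and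 $\mathcal{DN}(Q)$ is the set of such $x$. *)

(* Defs.v *)
From HB Require Import structures.
From mathcomp Require Import all_boot all_order all_algebra.
From mathcomp Require Import all_classical all_reals all_analysis.

Set Implicit Arguments.
Unset Strict Implicit.
Unset Printing Implicit Defensive.

Import Order.TTheory GRing.Theory Num.Theory.
Import numFieldNormedType.Exports.

Local Open Scope classical_set_scope.
Local Open Scope ring_scope.

(* Sequences (q_n)_{n >= 1} and (E_n)_{n >= 1} are functions [nat -> nat] used
   only at positive indices; the value at 0 is never consulted. *)
Definition basic_sequence (q : nat -> nat) : Prop :=
  forall n, (1 <= n)%N -> (2 <= q n)%N.

Section CantorSeries.
Variable R : realType.
Implicit Types (q E : nat -> nat) (x : R).

Definition cantor_expansion q x (E0 : int) E : Prop :=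
  [/\ E0 = Num.floor x,
      forall n, (1 <= n)%N -> (E n < q n)%N,
      forall m, exists n, [/\ (1 <= n)%N, (m <= n)%N & E n <> (q n - 1)%N] &
      E0%:~R + \sum_(1 <= n < N.+1) (E n)%:R / (\prod_(1 <= i < n.+1) q i)%:R
        @[N --> \oo] --> x].

(* N_n(B, x) in terms of the digits E of x: only occurrences lying entirely
   inside E_1, ..., E_n are counted, i.e. i + k - 1 <= n. *)
Definition block_count E (k : nat) (B : k.-tuple nat) (n : nat) : nat :=
  count (fun i => (i + k <= n.+1)%N && ([seq E j | j <- iota i k] == B))
        (iota 1 n).

Definition Qnk q (k n : nat) : R :=
  \sum_(1 <= j < n.+1) (\prod_(j <= i < j + k) q i)%:R^-1.

(* Every real has exactly one expansion (E0, E), so the existential below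
   merely names the digits of x. *)
Definition normal_of_order q (k : nat) x : Prop :=
  exists (E0 : int) E, cantor_expansion q x E0 E /\
    forall B : k.-tuple nat,
      (block_count E B n)%:R / Qnk q k n @[n --> \oo] --> (1 : R).

Definition normal_set q : set R :=
  [set x | forall k, (1 <= k)%N -> normal_of_order q k x].

Definition fract x : R := x - (Num.floor x)%:~R.

Definition cantor_T q (n : nat) x : R := fract ((\prod_(1 <= i < n.+1) q i)%:R * x).

Definition unif_dist_mod1 (u : nat -> R) : Prop :=
  forall a b : R, 0 <= a -> a < b -> b <= 1 ->
    (count (fun n => a <= fract (u n) < b) (iota 0 N))%:R / N%:R
      @[N --> \oo] --> b - a.

Definition dist_normal_set q : set R :=
  [set x | unif_dist_mod1 (fun n => cantor_T q n x)].

Definition U_set q : set R :=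
  [set x | (exists E, cantor_expansion q x 0 E) /\
     forall r s : rat, r != 0 ->
       (normal_set q `\` dist_normal_set q) (ratr r * x + ratr s)].

End CantorSeries.

Section Hausdorff.
Variable R : realType.
Implicit Types (A : set R) (s delta : R).
Local Open Scope ereal_scope.

Definition diameter A : \bar R :=
  ereal_sup [set `|p.1 - p.2|%:E | p in A `*` A].

(* The empty set weighs 0 also for s = 0, so that countable covers include
   finite ones; a singleton weighs 0 `^ 0 = 1 for s = 0. *)
Definition diam_pow s A : \bar R :=
  if pselect (A = set0) then 0 else poweR (diameter A) s.

Definition hausdorff_content s delta A : \bar R :=
  ereal_inf [set \sum_(0 <= i <oo) diam_pow s (F i) | F in
    [set F : nat -> set R | A `<=` \bigcup_i F i /\
                            forall i, diameter (F i) <= delta%:E]].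

Definition hausdorff_measure s A : \bar R :=
  ereal_sup [set hausdorff_content s delta A | delta in
    [set delta : R | (0 < delta)%R]].

Definition hausdorff_dim A : \bar R :=
  ereal_inf [set s%:E | s in
    [set s : R | (0 <= s)%R /\ hausdorff_measure s A = 0]].

End Hausdorff.

(* Main.v *)
(** Positions are grouped into runs of length [2l]. The first [l] positions of a
    run are "special": there [q = M] is small and the digits of [x] spell, in
    base [M], a prescribed number [y < M^l]. The other [l] positions are "free":
    there [q] is huge and the digit is a multiple of [M] in a window of relative
    size [1/M]. A pass lets [y] run through all of [0, M^l); the parameters grow
    so slowly that one pass is negligible against all previous ones, and [M]
    eventually is divisible by any given integer.

    Let [z = (a x + e) / b]. On the special positions, away from the ends of the
    run, the digits of [z] are those of the quotient of [y] by a divisor of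
    [M^l] (complemented if [a < 0]), so over a pass every block of length [k]
    occurs exactly the expected number of times at each such place. On the free
    positions the digits of [z] tend to infinity and do not matter. Hence [z] is
    normal. When two consecutive positions are free, [T_n z] is within [|a|/M] of
    an integer; this happens with frequency about 1/2, so [z] is not distribution
    normal.

    The free digits carry almost all of [log q], so sending [u] in [0, 1) to the
    point whose free digits are the digits of [u] (in base [branching]) expands
    distances up to an arbitrarily small Hoelder loss, and countable
    subadditivity of Lebesgue measure bounds every Hausdorff content of exponent
    [s < 1] from below. *)

Require Import Defs.
From mathcomp Require Import all_boot all_order all_algebra.
From mathcomp Require Import all_classical all_reals all_analysis.
From mathcomp Require Import zify ring lra.

Set Implicit Arguments.
Unset Strict Implicit.
Unset Printing Implicit Defensive.

Import Order.TTheory GRing.Theory Num.Theory.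
Import numFieldNormedType.Exports.

Local Open Scope classical_set_scope.
Local Open Scope ring_scope.

(** * Counting integers with prescribed consecutive digits *)

Lemma big_nat_mul_split (V : nmodType) (f : nat -> V) (a b : nat) :
  \sum_(0 <= p < a * b) f p =
  \sum_(0 <= y < a) \sum_(0 <= i < b) f (y * b + i)%N.
Proof.
elim: a => [|a IH]; first by rewrite mul0n !big_geq.
rewrite big_nat_recr //= -IH mulSnr (big_cat_nat (n := a * b)) //=; last by lia.
congr (_ + _); rewrite -{1}[(a * b)%N]add0n big_addn.
rewrite addKn; apply: eq_bigr => i _; congr f; lia.
Qed.

Lemma sum_modn_eq (M u b : nat) : (b < M)%N ->
  (\sum_(0 <= y < u * M) (y %% M == b) = u)%N.
Proof.
move=> bM; rewrite (@big_nat_mul_split nat) /=.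
rewrite (eq_bigr (fun=> 1%N)); first by rewrite sum_nat_const_nat; lia.
move=> y _; rewrite (eq_big_nat _ _ (F2 := fun i => nat_of_bool (i == b))).
  rewrite big_mkord (bigD1 (Ordinal bM)) //= eqxx big1 // => i.
  by rewrite -val_eqE /= => /negbTE->.
by move=> i /andP[_ iM]; rewrite modnMDl modn_small.
Qed.

(** Induction on [k]: in [y = y1 * (h * M ^ k) + y0] the leading digit depends only on [y1] modulo
    [M], the others only on [y0]. As [h] need not be a power of [M], the count also applies to the
    digits of a quotient of [y]. *)
Lemma sum_digit_block (M k h u : nat) (B : nat -> nat) :
  (0 < M)%N -> (0 < h)%N -> (forall i, (i < k)%N -> (B i < M)%N) ->
  (\sum_(0 <= y < u * (h * M ^ k))
     all (fun i => (y %/ (h * M ^ (k - i.+1))) %% M == B i) (iota 0 k)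
   = u * h)%N.
Proof.
move=> M0 h0; elim: k u B => [|k IH] u B BM.
  by rewrite expn0 muln1 /= sum_nat_const_nat subn0 muln1.
have -> : (u * (h * M ^ k.+1) = (u * M) * (h * M ^ k))%N by rewrite expnS; nia.
rewrite (@big_nat_mul_split nat) /=.
have hMk y : (0 < h * M ^ y)%N by rewrite muln_gt0 h0 expn_gt0 M0.
under eq_bigr => y1 _.
  rewrite (eq_big_nat _ _ (F2 := fun y0 => ((y1 %% M == B 0%N) *
     all (fun i => (y0 %/ (h * M ^ (k - i.+1))) %% M == B i.+1) (iota 0 k))%N)).
    rewrite -big_distrr /=.
    have := IH 1%N (B \o S); rewrite !mul1n => -> /=; last first.
      by move=> i ik; apply: BM.
    over.
  move=> y0 /andP[_ y0lt]; rewrite -mulnb subSS subn0.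
  rewrite divnMDl // (divn_small y0lt) addn0; congr (_ * nat_of_bool _)%N.
  rewrite -[X in iota X _]/(1 + 0)%N iotaDl all_map; apply: eq_in_all => i.
  rewrite mem_iota add0n => /= ik.
  rewrite add1n subSS.
  have -> : (y1 * (h * M ^ k) + y0 =
             (y1 * M ^ i * M) * (h * M ^ (k - i.+1)) + y0)%N.
    have [d ->] : exists d, k = (i + d.+1)%N by exists (k - i.+1)%N; lia.
    have -> : (i + d.+1 - i.+1 = d)%N by lia.
    by rewrite expnD expnS; ring.
  by rewrite divnMDl // modnMDl.
by rewrite -big_distrl /= sum_modn_eq ?BM.
Qed.

(** * The layout of the basic sequence *)

(* [modulus m], [halfrun m], [nruns m] and [passlen m] are M, l, M^l and the
   length of a pass at level m. Pass j starts at position [start j] and has level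
   [level j], the largest one for which the square of the pass length is O(j).
   Positions count from 0: position p carries the digit of index p + 1. *)
Definition modulus (m : nat) : nat := (m.+2)`!.
Definition halfrun (m : nat) : nat := (m.+1 * modulus m ^ m.+1)%N.
Definition nruns (m : nat) : nat := (modulus m ^ halfrun m)%N.
Definition passlen (m : nat) : nat := (nruns m * (2 * halfrun m))%N.
Definition slack : nat := (passlen 0 ^ 2)%N.
Definition level (j : nat) : nat :=
  \max_(i < j.+1 | (passlen i ^ 2 <= j + slack)%N) i.
Definition start (j : nat) : nat := (\sum_(0 <= i < j) passlen (level i))%N.

Lemma modulus_ge2 m : (2 <= modulus m)%N.
Proof. exact: leq_trans (fact_geq _). Qed.

Lemma modulus_gem m : (m.+2 <= modulus m)%N.
Proof. exact: fact_geq. Qed.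

Lemma dvdn_modulus d m : (0 < d)%N -> (d <= m.+2)%N -> (d %| modulus m)%N.
Proof. by move=> d0 dm; apply: dvdn_fact; rewrite d0. Qed.

Lemma halfrun_gt0 m : (0 < halfrun m)%N.
Proof. by rewrite muln_gt0 /= expn_gt0 (leq_trans _ (modulus_ge2 m)). Qed.

(** The factor [m.+1] makes the expected number of occurrences of a block of length [k] per run at
    least [m.+1 - k], which outgrows the bounded error made at the ends of a run. *)
Lemma halfrun_ge m k : (k <= m.+1)%N ->
  (m.+1 * modulus m ^ k <= halfrun m)%N.
Proof.
move=> km; rewrite leq_mul2l /= leq_pexp2l //.
exact: leq_trans (modulus_ge2 m).
Qed.

Lemma halfrun_gem m : (m.+1 < halfrun m)%N.
Proof.
have := @halfrun_ge m 1 isT; rewrite expn1; have := modulus_ge2 m; nia.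
Qed.

Lemma modulus_le_halfrun m : (modulus m <= halfrun m)%N.
Proof. have := @halfrun_ge m 1 isT; rewrite expn1; nia. Qed.

Lemma nruns_gt0 m : (0 < nruns m)%N.
Proof. by rewrite expn_gt0 (leq_trans _ (modulus_ge2 m)). Qed.

Lemma passlen_gt0 m : (0 < passlen m)%N.
Proof. by rewrite muln_gt0 nruns_gt0 muln_gt0 halfrun_gt0. Qed.

Lemma halfrun_le_passlen m : (2 * halfrun m <= passlen m)%N.
Proof. by rewrite /passlen leq_pmull // nruns_gt0. Qed.

Lemma modulus_sqr_le_passlen m : (2 * modulus m ^ 2 <= passlen m)%N.
Proof.
have l1 := modulus_le_halfrun m.
have : (modulus m ^ 1 <= nruns m)%N.
  rewrite leq_pexp2l ?halfrun_gt0 //; exact: leq_trans (modulus_ge2 m).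
rewrite /passlen expn1 => l2.
have := leq_mul l2 l1; nia.
Qed.

Global Opaque modulus halfrun nruns passlen slack.

(** [slack] makes level 0 admissible for every pass, so the maximum defining [level] ranges over a
    nonempty set and is attained. *)
Lemma passlen_level j : (passlen (level j) ^ 2 <= j + slack)%N.
Proof.
rewrite /level.
have P0 : (passlen (@ord0 j) ^ 2 <= j + slack)%N by rewrite leq_addl.
have [i Pi ->] := @eq_bigmax_cond _
  (fun i : 'I_j.+1 => (passlen i ^ 2 <= j + slack)%N) (@nat_of_ord _)
  ltac:(by apply/card_gt0P; exists ord0).
exact: Pi.
Qed.

Lemma passlen_level_le j : (passlen (level j) <= j + slack)%N.
Proof. have := passlen_level j; have := passlen_gt0 (level j); nia. Qed.

Lemma level_unbounded m : exists j0, forall j, (j0 <= j)%N -> (m <= level j)%N.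
Proof.
exists (maxn m (passlen m ^ 2))%N => j; rewrite geq_max => /andP[mj Pj].
have mj1 : (m < j.+1)%N by [].
apply: (@leq_bigmax_cond _
  (fun i : 'I_j.+1 => (passlen i ^ 2 <= j + slack)%N)
  (@nat_of_ord _) (Ordinal mj1)).
by rewrite /= (leq_trans Pj) ?leq_addr.
Qed.

Lemma startS j : start j.+1 = (start j + passlen (level j))%N.
Proof. by rewrite /start big_nat_recr. Qed.

Lemma start0 : start 0 = 0%N.
Proof. by rewrite /start big_geq. Qed.

Lemma start_ltS j : (start j < start j.+1)%N.
Proof. by rewrite startS -[ltnLHS]addn0 ltn_add2l passlen_gt0. Qed.

Lemma start_le j j' : (j <= j')%N -> (start j <= start j')%N.
Proof.
move=> jj; apply: (homo_leq (@leqnn) leq_trans) jj => {j'}j'.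
exact: ltnW (start_ltS j').
Qed.

Lemma start_ge j : (j <= start j)%N.
Proof. elim: j => // j IH; have := start_ltS j; lia. Qed.

Lemma pass_exists p : exists j, (p < start j.+1)%N.
Proof. by exists p; have := start_ge p.+1; lia. Qed.

(** * Coordinates of a position: pass, run and offset *)

Definition pass (p : nat) : nat := ex_minn (pass_exists p).

Lemma passP p : (start (pass p) <= p < start (pass p).+1)%N.
Proof.
rewrite /pass; case: ex_minnP => j -> min; rewrite andbT leqNgt; apply/negP.
case: j min => [|j] min; first by rewrite start0.
by move=> /min; rewrite ltnn.
Qed.

Lemma pass_unique p j : (start j <= p < start j.+1)%N -> pass p = j.
Proof.
move=> /andP[l1 l2]; have /andP[l3 l4] := passP p.
by case: (ltngtP (pass p) j) => // /start_le; lia.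
Qed.

Definition run_length p := (2 * halfrun (level (pass p)))%N.
(** The index of a run within its pass is also the number spelled by the special digits of the
    run. *)
Definition run p := ((p - start (pass p)) %/ run_length p)%N.
Definition offset p := ((p - start (pass p)) %% run_length p)%N.
Definition position j y i := (start j + (y * (2 * halfrun (level j)) + i))%N.

Lemma position_decode j y i :
  (y < nruns (level j))%N -> (i < 2 * halfrun (level j))%N ->
  [/\ pass (position j y i) = j, run (position j y i) = y &
      offset (position j y i) = i].
Proof.
move=> yN il.
have passE : pass (position j y i) = j.
  apply: pass_unique; rewrite leq_addr /= startS ltn_add2l.
  have -> : passlen (level j) = (nruns (level j) * (2 * halfrun (level j)))%N.
    by [].
  nia.
rewrite /run /offset /run_length passE addKn divnMDl; last by lia.
by rewrite (divn_small il) addn0 modnMDl modn_small.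
Qed.

Lemma run_lt p : (run p < nruns (level (pass p)))%N.
Proof.
have /andP[l1 l2] := passP p; have h0 := halfrun_gt0 (level (pass p)).
rewrite /run /run_length ltn_divLR; last by lia.
move: l2; rewrite startS.
have -> : passlen (level (pass p)) =
  (nruns (level (pass p)) * (2 * halfrun (level (pass p))))%N by [].
lia.
Qed.

Lemma offset_lt p : (offset p < 2 * halfrun (level (pass p)))%N.
Proof. by rewrite ltn_mod muln_gt0 halfrun_gt0. Qed.

Lemma positionK p : position (pass p) (run p) (offset p) = p.
Proof.
rewrite /position /run /offset /run_length -divn_eq subnKC //.
by case/andP: (passP p).
Qed.

Lemma sum_pass (V : nmodType) (f : nat -> V) j :
  \sum_(start j <= p < start j.+1) f p =
  \sum_(0 <= y < nruns (level j)) \sum_(0 <= i < 2 * halfrun (level j))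
    f (position j y i).
Proof.
rewrite -{1}[start j]add0n big_addn startS addKn.
rewrite -(@big_nat_mul_split _ (fun p => f (start j + p)%N)).
by apply: eq_bigr => p _; rewrite addnC.
Qed.

Definition special (p : nat) : bool := (offset p < halfrun (level (pass p)))%N.

(** * Cantor series digits *)

Lemma cvg_nat_epsP (R : realType) (u : nat -> R) (l : R) :
  (u n @[n --> \oo] --> l) <->
  (forall eps, 0 < eps -> exists N, forall n, (N <= n)%N -> `|u n - l| <= eps).
Proof.
split=> [/cvgrPdist_le cvu eps eps0|H].
  have [N _ HN] := cvu _ eps0; exists N => n Nn.
  by rewrite distrC; apply: HN.
apply/cvgrPdist_le => eps eps0; have [N HN] := H _ eps0.
by exists N => // n /= Nn; rewrite distrC; apply: HN.
Qed.

Definition cprod (q : nat -> nat) (n : nat) : nat := (\prod_(1 <= i < n.+1) q i)%N.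

Lemma cprod0 q : cprod q 0 = 1%N.
Proof. by rewrite /cprod big_geq. Qed.

Lemma cprodS q n : cprod q n.+1 = (cprod q n * q n.+1)%N.
Proof. by rewrite /cprod big_nat_recr. Qed.

Lemma cprod_gt0 q n : (forall i, (0 < q i)%N) -> (0 < cprod q n)%N.
Proof.
by move=> q0; elim: n => [|n IH]; rewrite ?cprod0 // cprodS muln_gt0 IH q0.
Qed.

Lemma cprod_le q m n : (forall i, (0 < q i)%N) -> (m <= n)%N ->
  (cprod q m <= cprod q n)%N.
Proof.
move=> q0; apply: (homo_leq (@leqnn) leq_trans) => {}n.
by rewrite cprodS leq_pmulr.
Qed.

Lemma cprod_ge_exp2 q n : (forall i, (2 <= q i)%N) -> (2 ^ n <= cprod q n)%N.
Proof.
move=> q2; elim: n => [|n IH]; first by rewrite cprod0.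
by rewrite cprodS expnSr leq_mul.
Qed.

Section CantorDigits.
Variable R : realType.
Implicit Types (q E : nat -> nat) (z : R).

(** For positive [q n] the remainder is nonnegative even if [z] is negative, so the absolute value
    only converts it to [nat]. *)
Definition cdigit q z (n : nat) : nat :=
  `|(Num.floor ((cprod q n)%:R * z) %% (q n)%:Z)%Z|%N.

Lemma floor_unique (w : R) (m : int) :
  m%:~R <= w -> w < m%:~R + 1 -> Num.floor w = m.
Proof. by move=> h1 h2; apply: floor_def; rewrite h1 intrD. Qed.

Lemma floor_bounds (w : R) :
  (Num.floor w)%:~R <= w < (Num.floor w)%:~R + 1.
Proof. by have := floor_itv w; rewrite intrD. Qed.

Lemma floor_mul_divz (k : nat) (w : R) : (0 < k)%N ->
  (Num.floor (k%:R * w) %/ k%:Z)%Z = Num.floor w.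
Proof.
move=> k0; have kR : (0 : R) < k%:R by rewrite ltr0n.
set f := Num.floor w; set Y := Num.floor _.
have /andP[f1 f2] := floor_bounds w; rewrite -/f in f1 f2.
have le1 : f * k%:Z <= Y.
  by rewrite floor_ge_int intrM mulrC /= ler_pM2l.
have lt1 : Y < (f + 1) * k%:Z.
  by rewrite floor_lt_int intrM intrD mulrC /= ltr_pM2r.
have -> : Y = f * k%:Z + (Y - f * k%:Z) by ring.
rewrite divzMDl; last by lia.
by rewrite divz_small ?addr0 //; move: le1 lt1; rewrite mulrDl mul1r; lia.
Qed.

Lemma cdigit_lt q z n : (0 < q n)%N -> (cdigit q z n < q n)%N.
Proof.
move=> q0; rewrite /cdigit.
have h1 := @modz_ge0 (Num.floor ((cprod q n)%:R * z)) (q n)%:Z.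
have h2 := @ltz_pmod (Num.floor ((cprod q n)%:R * z)) (q n)%:Z.
by move: h1 h2; set t := (_ %% _)%Z; lia.
Qed.

Lemma floor_cprodS q z n : (0 < q n.+1)%N ->
  Num.floor ((cprod q n.+1)%:R * z) =
  Num.floor ((cprod q n)%:R * z) * (q n.+1)%:Z + (cdigit q z n.+1)%:Z.
Proof.
move=> q0.
have E : (cprod q n.+1)%:R * z = (q n.+1)%:R * ((cprod q n)%:R * z) :> R.
  by rewrite cprodS natrM; ring.
rewrite /cdigit.
have := divz_eq (Num.floor ((cprod q n.+1)%:R * z)) (q n.+1)%:Z.
rewrite {2}E floor_mul_divz // => {1}->.
by rewrite gez0_abs // modz_ge0 //; lia.
Qed.

Lemma cdigit_unique q z n (J : int) (d : nat) :
  Num.floor ((cprod q n)%:R * z) = J * (q n)%:Z + d%:Z -> (d < q n)%N ->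
  cdigit q z n = d.
Proof.
by move=> fE dq; rewrite /cdigit fE modzMDl modz_small //; lia.
Qed.

Lemma cdigit_ge q z n (H : int) (beta : R) (L : nat) :
  (cprod q n)%:R * z = H%:~R * (q n)%:R + beta -> L%:R <= beta ->
  beta < (q n)%:R -> (L <= cdigit q z n)%N.
Proof.
move=> zE Lb bq.
have b0 : 0 <= beta by apply: le_trans Lb.
have f0 : 0 <= Num.floor beta by rewrite floor_ge0.
have fE : Num.floor beta = `|Num.floor beta|%N%:Z by rewrite gez0_abs.
have fq : (`|Num.floor beta| < q n)%N.
  have : Num.floor beta < (q n)%:Z by rewrite floor_lt_int.
  by rewrite fE ltz_nat.
rewrite (@cdigit_unique q z n H `|Num.floor beta|%N) //.
  have : L%:Z <= Num.floor beta by rewrite floor_ge_int.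
  by rewrite {1}fE.
rewrite zE floorDzr; last by rewrite rpredM // ?intr_int // rpred_nat.
rewrite -fE; congr (_ + _); rewrite -[(q n)%:R]/((q n)%:Z%:~R) -intrM.
exact: intrKfloor.
Qed.

(** Telescoping: [floor_cprodS] is Horner's rule for the floors of the scaled number. *)
Lemma sum_cdigit q z N : (forall i, (2 <= q i)%N) ->
  (Num.floor z)%:~R + \sum_(1 <= n < N.+1) (cdigit q z n)%:R / (cprod q n)%:R
  = (Num.floor ((cprod q N)%:R * z))%:~R / (cprod q N)%:R :> R.
Proof.
move=> q2; have q0 i : (0 < q i)%N by apply: leq_trans (q2 i).
elim: N => [|N IH]; first by rewrite big_geq // cprod0 mul1r divr1 addr0.
rewrite big_nat_recr //= addrA IH floor_cprodS // intrD intrM /=.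
rewrite cprodS natrM.
have n1 : (cprod q N)%:R != 0 :> R by rewrite pnatr_eq0 -lt0n cprod_gt0.
have n2 : (q N.+1)%:R != 0 :> R by rewrite pnatr_eq0 -lt0n.
by rewrite -!pmulrn; field; rewrite n1 n2.
Qed.

Lemma inv_cprod_small q (eps : R) : (forall i, (2 <= q i)%N) -> 0 < eps ->
  exists N, forall n, (N <= n)%N -> (cprod q n)%:R^-1 <= eps.
Proof.
move=> q2 e0; have q0 i : (0 < q i)%N by apply: leq_trans (q2 i).
(* A bound above [1 / eps] suffices, as the product of the first [n] terms is at least [2 ^ n],
   hence at least [n]. *)
exists (Num.truncn eps^-1).+1 => n Nn.
rewrite invf_ple ?posrE ?ltr0n ?cprod_gt0 //.
apply: le_trans (ltW (truncnS_gt _)) _; rewrite ler_nat.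
apply: leq_trans Nn _; apply: leq_trans (cprod_ge_exp2 n q2).
exact: ltnW (ltn_expl _ _).
Qed.

Lemma cantor_expansion_cdigit q z : (forall i, (2 <= q i)%N) ->
  cantor_expansion q z (Num.floor z) (cdigit q z).
Proof.
move=> q2; have q0 i : (0 < q i)%N by apply: leq_trans (q2 i).
have P0 n : (0 : R) < (cprod q n)%:R by rewrite ltr0n cprod_gt0.
split=> //.
- by move=> n _; apply: cdigit_lt.
- move=> m; apply: contrapT => Hm.
  have H n : (m <= n)%N -> cdigit q z n.+1 = (q n.+1 - 1)%N.
    by move=> mn; apply: contrapT => D; apply: Hm; exists n.+1; split => //; lia.
  (* All later digits are maximal, so (floor (P_n z) + 1) / P_n does not depend
     on n, although it exceeds z and tends to z. *)
  pose g n : R := ((Num.floor ((cprod q n)%:R * z))%:~R + 1) / (cprod q n)%:R.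
  have gE n : (m <= n)%N -> g n = g m.
    elim: n => [|n IH]; first by rewrite leqn0 => /eqP->.
    rewrite leq_eqVlt => /predU1P[->//|]; rewrite ltnS => mn.
    rewrite -IH // /g floor_cprodS // H // cprodS natrM.
    have n1 : (cprod q n)%:R != 0 :> R by rewrite gt_eqF.
    have n2 : (q n.+1)%:R != 0 :> R by rewrite pnatr_eq0 -lt0n.
    have -> : (q n.+1 - 1)%N%:Z = (q n.+1)%:Z - 1 by rewrite -subzn.
    by rewrite intrD intrM intrB -!pmulrn; field; rewrite n1 n2.
  have gz n : z < g n.
    have /andP[_] := floor_bounds ((cprod q n)%:R * z).
    by rewrite ltr_pdivlMr // [z * _]mulrC.
  have [N HN] := @inv_cprod_small q ((g m - z) / 2) q2
    ltac:(by rewrite divr_gt0 // subr_gt0).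
  pose n := maxn m N.
  have /andP[f1 _] := floor_bounds ((cprod q n)%:R * z).
  have : g n <= z + (cprod q n)%:R^-1.
    by rewrite /g mulrDl mul1r lerD2r ler_pdivrMr // [z * _]mulrC.
  rewrite gE ?leq_maxl //; have := HN n (leq_maxr _ _); have := gz m; lra.
- apply/cvg_nat_epsP => eps e0.
  have [N HN] := @inv_cprod_small q eps q2 e0.
  exists N => n Nn; rewrite sum_cdigit //.
  have /andP[f1 f2] := floor_bounds ((cprod q n)%:R * z).
  have := HN _ Nn; have := P0 n; move: f1 f2.
  set P := (cprod q n)%:R; set f := (_%:~R); move=> f1 f2 Pp eP.
  rewrite ler_norml; apply/andP; split.
    rewrite lerBrDl ler_pdivlMr // mulrDl.
    have : 1 <= eps * P by rewrite -ler_pdivrMr // mul1r.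
    lra.
  have : f / P <= z by rewrite ler_pdivrMr // mulrC.
  lra.
Qed.

Fixpoint cnum q E (n : nat) : nat :=
  if n is k.+1 then (cnum q E k * q k.+1 + E k.+1)%N else 0%N.

(** For digits below a basic sequence the partial sums are nondecreasing and bounded, so the
    supremum is the sum of the series. *)
Definition creal q E : R :=
  sup (range (fun n => (cnum q E n)%:R / (cprod q n)%:R)).

(** The partial sums and their upper companions [(cnum + 1) / cprod] bound nested intervals around
    the point. A later digit that is neither 0 nor maximal moves both ends strictly inwards; the
    strict lower bound matters for [a < 0]. *)
Lemma creal_bounds q E : (forall i, (2 <= q i)%N) ->
  (forall n, (E n.+1 < q n.+1)%N) ->
  (forall n, exists2 k, (n < k)%N & (0 < E k)%N && ((E k).+1 < q k)%N) ->
  forall n, (cnum q E n)%:R < (cprod q n)%:R * creal q E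
            < (cnum q E n)%:R + 1.
Proof.
move=> q2 Eq Einf; have q0 i : (0 < q i)%N by apply: leq_trans (q2 i).
have P0 n : (0 : R) < (cprod q n)%:R by rewrite ltr0n cprod_gt0.
pose lo n : R := (cnum q E n)%:R / (cprod q n)%:R.
pose hi n : R := ((cnum q E n)%:R + 1) / (cprod q n)%:R.
have n1 n : (cprod q n)%:R != 0 :> R by rewrite gt_eqF.
have n2 n : (q n)%:R != 0 :> R by rewrite pnatr_eq0 -lt0n.
have loS n : lo n.+1 = lo n + (E n.+1)%:R / (cprod q n.+1)%:R.
  rewrite /lo /= natrD natrM cprodS natrM; field; rewrite n1 n2 //.
have hiS n : hi n.+1 = hi n - ((q n.+1)%:R - (E n.+1).+1%:R) / (cprod q n.+1)%:R.
  rewrite /hi /= natrD natrM cprodS natrM -natr1; field; rewrite n1 n2 //.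
have lo1 n : lo n <= lo n.+1 by rewrite loS lerDl divr_ge0.
have hi1 n : hi n.+1 <= hi n.
  by rewrite hiS gerBl divr_ge0 // subr_ge0 ler_nat.
have lom m n : (m <= n)%N -> lo m <= lo n.
  exact: (homo_leq (@lexx _ _) (fun _ _ _ => @le_trans _ _ _ _ _)).
have him m n : (m <= n)%N -> hi n <= hi m.
  by apply: (homo_leq (r := fun a b : R => b <= a) (@lexx _ _)) => // a b c ba ac;
     apply: le_trans ac ba.
have lohi m n : lo m < hi n.
  apply: le_lt_trans (lom _ _ (leq_maxl m n)) _.
  apply: lt_le_trans (him _ _ (leq_maxr m n)).
  by rewrite ltr_pM2r ?invr_gt0 // ltrDl.
have ub n : ubound (range lo) (hi n) by move=> _ [m _ <-]; exact: ltW.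
have lole n : lo n <= creal q E.
  by apply: ub_le_sup; [exists (hi 0%N)|exists n].
have lehi n : creal q E <= hi n.
  by apply: ge_sup => //; exists (lo 0%N); exists 0%N.
move=> n; have [k nk /andP[Ek0 Ekq]] := Einf n.
have [k' kE] : exists k', k = k'.+1 by exists k.-1; lia.
subst k.
have lt1 : lo n < creal q E.
  apply: lt_le_trans (lole k'.+1); apply: le_lt_trans (lom n k' _) _ => //.
  by rewrite loS ltrDl divr_gt0 // ltr0n.
have lt2 : creal q E < hi n.
  apply: le_lt_trans (lehi k'.+1) _; apply: lt_le_trans (him n k' _) => //.
  by rewrite hiS gtrBl divr_gt0 // subr_gt0 ltr_nat.
by rewrite -ltr_pdivrMl // mulrC lt1 mulrC -ltr_pdivlMr.
Qed.

End CantorDigits.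

(** * The basic sequence and the points of the Cantor set *)

Definition plevel (p : nat) : nat := level (pass p).

(* On special positions [branching] is 1, so that base [branching] has digits
   only on the free positions. *)
Definition branching (n : nat) : nat :=
  if special n.-1 then 1%N else (2 ^ ((n + slack) ^ 3))%N.

(** The part of [qseq] invisible to the parametrisation. On a free position one factor [M] spaces
    the digits, the other confines them to a window of relative size [1 / M], and the 2 absorbs the
    width of one unit. *)
Definition residual (n : nat) : nat :=
  if special n.-1 then modulus (plevel n.-1) else (2 * modulus (plevel n.-1) ^ 2)%N.

Definition qseq (n : nat) : nat := (branching n * residual n)%N.

Lemma branching_gt0 n : (0 < branching n)%N.
Proof. by rewrite /branching; case: ifP => //; rewrite expn_gt0. Qed.

Lemma qseq_special p : special p -> qseq p.+1 = modulus (plevel p).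
Proof. by rewrite /qseq /branching /residual /= => ->; rewrite mul1n. Qed.

Lemma qseq_free p : ~~ special p ->
  qseq p.+1 = (branching p.+1 * (2 * modulus (plevel p) ^ 2))%N.
Proof. by rewrite /qseq /residual /= => /negbTE->. Qed.

Lemma residual_ge2 n : (2 <= residual n)%N.
Proof.
rewrite /residual; case: ifP => _; first exact: modulus_ge2.
by have := modulus_ge2 (plevel n.-1); nia.
Qed.

Lemma qseq_ge2 n : (2 <= qseq n)%N.
Proof.
by rewrite /qseq; have := branching_gt0 n; have := residual_ge2 n; nia.
Qed.

Lemma qseq_gt0 n : (0 < qseq n)%N.
Proof. exact: leq_trans (qseq_ge2 n). Qed.

Lemma modulus_dvd_qseq p : (modulus (plevel p) %| qseq p.+1)%N.
Proof.
rewrite /qseq /residual /= dvdn_mull //; case: ifP => // _.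
by rewrite dvdn_mull // dvdn_exp.
Qed.

Lemma passlen_plevel_le p : (passlen (plevel p) <= p + slack)%N.
Proof.
apply: leq_trans (passlen_level_le _) _; rewrite leq_add2r.
by have /andP[h _] := passP p; apply: leq_trans (start_ge _) h.
Qed.

Lemma branching_free_ge p : ~~ special p -> (p.+1 + slack <= branching p.+1)%N.
Proof.
rewrite /branching /= => /negbTE->.
apply: leq_trans (ltnW (ltn_expl _ (isT : (1 < 2)%N))) _.
by rewrite leq_exp2l // -{1}[(p.+1 + slack)%N]expn1 leq_pexp2l // addSn.
Qed.

(** Bounds the expected count on the free half of a run by 1: there are [halfrun] places, each of
    weight at most [1 / halfrun]. *)
Lemma qseq_free_ge_halfrun p : ~~ special p -> (halfrun (plevel p) <= qseq p.+1)%N.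
Proof.
move=> Sp; rewrite qseq_free //.
have h1 := branching_free_ge Sp; have h2 := passlen_plevel_le p.
have h3 := halfrun_le_passlen (plevel p); have h4 := modulus_ge2 (plevel p).
have : (halfrun (plevel p) <= branching p.+1)%N by lia.
move=> h; apply: leq_trans h _; rewrite leq_pmulr //; nia.
Qed.

Lemma special_position j y i :
  (y < nruns (level j))%N -> (i < 2 * halfrun (level j))%N ->
  special (position j y i) = (i < halfrun (level j))%N.
Proof.
by move=> yN il; rewrite /special; have [-> _ ->] := position_decode yN il.
Qed.

Lemma plevel_position j y i :
  (y < nruns (level j))%N -> (i < 2 * halfrun (level j))%N ->
  plevel (position j y i) = level j.
Proof.
by move=> yN il; rewrite /plevel; have [-> _ _] := position_decode yN il.
Qed.

Lemma positionD j y i k : (position j y i + k)%N = position j y (i + k).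
Proof. by rewrite /position !addnA. Qed.

Section Points.
Variable R : realType.
Implicit Types (u : R).

(** A run spells its index with the most significant digit first. The successor on free positions
    keeps the digit at least [M]. *)
Definition pdigit u (n : nat) : nat :=
  let m := plevel n.-1 in
  if special n.-1
  then ((run n.-1 %/ modulus m ^ (halfrun m - (offset n.-1).+1)) %% modulus m)%N
  else (modulus m * (cdigit branching u n).+1)%N.

Definition cantor_point u : R := creal R qseq (pdigit u).

Lemma pdigit_free u p : ~~ special p ->
  pdigit u p.+1 = (modulus (plevel p) * (cdigit branching u p.+1).+1)%N.
Proof. by rewrite /pdigit /= => /negbTE->. Qed.

Lemma pdigit_free_le u p : ~~ special p ->
  (modulus (plevel p) * (pdigit u p.+1).+1 <= qseq p.+1)%N.
Proof.
move=> Sp; rewrite pdigit_free // qseq_free //.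
have := cdigit_lt u (branching_gt0 p.+1).
have := modulus_ge2 (plevel p).
move: (cdigit _ _ _) (branching _) (modulus _) => t K M M2 tK.
have : (M * t.+1 + 1 <= 2 * M * K)%N by nia.
by move=> h; apply: leq_trans (_ : M * (2 * M * K) <= _)%N; [rewrite leq_mul2l; lia|nia].
Qed.

Lemma pdigit_lt u p : (pdigit u p.+1 < qseq p.+1)%N.
Proof.
case: (boolP (special p)) => Sp.
  rewrite qseq_special // /pdigit /= Sp ltn_mod.
  exact: leq_trans (modulus_ge2 _).
apply: leq_trans (pdigit_free_le u Sp); rewrite leq_pmull //.
exact: leq_trans (modulus_ge2 _).
Qed.

Lemma free_exists n : exists2 p, (n <= p)%N & ~~ special p.
Proof.
have h0 := halfrun_gt0 (level n).
exists (position n 0 (halfrun (level n))).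
  by rewrite (leq_trans (start_ge n)) // leq_addr.
by rewrite special_position ?nruns_gt0 ?ltnn //; lia.
Qed.

Lemma point_bounds u n :
  (cnum qseq (pdigit u) n)%:R < (cprod qseq n)%:R * cantor_point u
    < (cnum qseq (pdigit u) n)%:R + 1.
Proof.
apply: creal_bounds; [exact: qseq_ge2|exact: pdigit_lt|].
move=> {}n; have [p np Sp] := free_exists n; exists p.+1 => //.
apply/andP; split.
  by rewrite pdigit_free // muln_gt0 (leq_trans _ (modulus_ge2 _)).
by apply: leq_trans (pdigit_free_le u Sp); rewrite ltn_Pmull ?modulus_ge2.
Qed.

(** * Digits of the affine images on special positions *)

Lemma cprod_run j y i : (y < nruns (level j))%N -> (i <= halfrun (level j))%N ->
  cprod qseq (position j y 0 + i) =
  (cprod qseq (position j y 0) * modulus (level j) ^ i)%N.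
Proof.
move=> yN; elim: i => [|i IH] il; first by rewrite addn0 muln1.
have h0 := halfrun_gt0 (level j).
rewrite addnS cprodS IH; last by lia.
rewrite positionD add0n qseq_special ?special_position //; [|lia].
by rewrite plevel_position //; [rewrite expnSr mulnA|lia].
Qed.

(** Horner's rule for the leading digits of [y]; at [i = halfrun] the whole of [y] has been
    appended. *)
Lemma cnum_run u j y i : (y < nruns (level j))%N -> (i <= halfrun (level j))%N ->
  cnum qseq (pdigit u) (position j y 0 + i) =
  (cnum qseq (pdigit u) (position j y 0) * modulus (level j) ^ i
   + y %/ modulus (level j) ^ (halfrun (level j) - i))%N.
Proof.
move=> yN; elim: i => [|i IH] il.
  by rewrite addn0 muln1 subn0 divn_small ?addn0.
have h0 := halfrun_gt0 (level j).
rewrite addnS [LHS]/= IH; last by lia.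
have i2 : (i < 2 * halfrun (level j))%N by lia.
rewrite positionD add0n qseq_special ?special_position //.
rewrite /pdigit /= special_position // il plevel_position //.
have [_ -> ->] := position_decode yN i2.
set M := modulus _; set l := halfrun _.
have -> : (l - i = (l - i.+1).+1)%N by rewrite subnSK.
rewrite [in LHS]expnSr divnMA expnSr.
rewrite [X in _ = (_ + X)%N](divn_eq (y %/ M ^ (l - i.+1)) M).
by ring.
Qed.

Lemma floor_add_divn (y h : nat) (tau : R) : (0 < h)%N -> 0 <= tau < 1 ->
  Num.floor ((y%:R + tau) / h%:R) = (y %/ h)%:Z.
Proof.
move=> h0 /andP[t0 t1]; have hR : (0 : R) < h%:R by rewrite ltr0n.
apply: floor_unique; rewrite -pmulrn.
  rewrite ler_pdivlMr // -natrM (le_trans (y := y%:R)) ?lerDl //.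
  by rewrite ler_nat leq_divM.
rewrite ltr_pdivrMr // (lt_le_trans (y := y%:R + 1)) ?ltrD2l //.
by rewrite !natr1 -natrM ler_nat ltn_ceil.
Qed.

(** With [0 < tau < 1] the quotient is never an integer, so negation sends its floor [f] to
    [- f - 1]. *)
Lemma floor_opp_add_divn (y h : nat) (tau : R) : (0 < h)%N -> 0 < tau < 1 ->
  Num.floor (- ((y%:R + tau) / h%:R)) = - (y %/ h)%:Z - 1.
Proof.
move=> h0 /andP[t0 t1]; have hR : (0 : R) < h%:R by rewrite ltr0n.
have l1 : (y %/ h)%:R < (y%:R + tau) / h%:R.
  rewrite ltr_pdivlMr // -natrM (le_lt_trans (y := y%:R)) ?ltrDl //.
  by rewrite ler_nat leq_divM.
have l2 : (y%:R + tau) / h%:R < (y %/ h)%:R + 1.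
  rewrite ltr_pdivrMr // (lt_le_trans (y := y%:R + 1)) ?ltrD2l //.
  by rewrite !natr1 -natrM ler_nat ltn_ceil.
by apply: floor_unique; rewrite intrB intrN -pmulrn; lra.
Qed.

Definition affine u (a e : int) (b : nat) : R := (a%:~R * cantor_point u + e%:~R) / b%:R.

Lemma intr_sign_absz (a : int) :
  a%:~R = (if 0 < a then 1 else -1) * `|a|%N%:R :> R.
Proof.
case: (ltP 0 a) => a1; first by rewrite mul1r pmulrn gtz0_abs.
by rewrite mulN1r pmulrn lez0_abs // mulrNz opprK.
Qed.

(** Splits the scaled image into an integer multiple of [M], which does not affect the digit, and a
    quotient of [y + tau]. One factor [M] absorbs the denominator [b]; the relation [A * h = b * G]
    merges [A], [b] and [G] into the single divisor [h]. *)
Lemma scaled_affineE (a e : int) (A b b' M k G h y X P : nat) (x tau sg : R) :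
  (0 < b)%N -> (0 < h)%N -> M = (b * b')%N -> a%:~R = sg * A%:R ->
  (A * h = b * G)%N ->
  y%:R + tau = G%:R * (P%:R * (M ^ k.+2)%N%:R * x - X%:R * (M ^ k.+2)%N%:R) ->
  (P * M ^ k.+2)%N%:R * ((a%:~R * x + e%:~R) / b%:R) =
  ((a * X%:Z + e * P%:Z) * b'%:Z * (M ^ k)%N%:Z * M%:Z)%:~R
  + sg * ((y%:R + tau) / h%:R).
Proof.
move=> b0 h0 ME aE AhE yt.
have bR : (b%:R : R) != 0 by rewrite pnatr_eq0 -lt0n.
have hR : (h%:R : R) != 0 by rewrite pnatr_eq0 -lt0n.
have AR : A%:R = b%:R * G%:R / h%:R :> R.
  by rewrite -natrM -AhE natrM mulfK.
rewrite yt !intrM intrD !intrM -!pmulrn natrM aE AR.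
have -> : (M ^ k.+2)%N%:R = b%:R * b'%:R * (M ^ k)%N%:R * M%:R :> R.
  by rewrite -!natrM -ME expnS expnSr mulnA.
move: ((M ^ k)%N%:R : R) (M%:R : R) => Mk MR.
by field; rewrite bR hR.
Qed.

(** Scaled to the end of the special half-run, the point is [X * M ^ l + y + tau] with
    [0 < tau < 1]. Scaling back to place [i] and multiplying by [a / b] divides [y + tau], up to
    sign, by [h = b * M ^ (l - i - 1) / |a|], an integer since [|a|] divides [M]; the rest is an
    integer multiple of [M]. *)
Lemma special_digit u (a e : int) (b j y i : nat) :
  let M := modulus (level j) in
  a != 0 -> (0 < b)%N -> (`|a| %| M)%N -> (b %| M)%N ->
  (y < nruns (level j))%N -> (0 < i)%N -> (i.+1 < halfrun (level j))%N ->
  let d := ((y %/ (b * (M %/ `|a|) * M ^ (halfrun (level j) - i.+2))) %% M)%N in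
  cdigit qseq (affine u a e b) (position j y i).+1 =
  if 0 < a then d else (M - 1 - d)%N.
Proof.
move=> M a0 b0 aM bM yN i0 il d.
have dE : d = ((y %/ (b * (M %/ `|a|) * M ^ (halfrun (level j) - i.+2))) %% M)%N by [].
clearbody d.
have M2 : (2 <= M)%N := modulus_ge2 _.
have i2 : (i < 2 * halfrun (level j))%N.
  by apply: ltn_trans (ltnW il) _; rewrite ltn_Pmull // halfrun_gt0.
have sp : special (position j y i) by rewrite special_position // ltnW.
have qM : qseq (position j y i).+1 = M by rewrite qseq_special // plevel_position.
have posE : (position j y i).+1 = (position j y 0 + i.+1)%N.
  by rewrite positionD add0n /position addnS addnS.
have PE := cprod_run yN (ltnW il).
have := point_bounds u (position j y 0 + halfrun (level j)).
rewrite cprod_run // cnum_run // -/M subnn expn0 divn1.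
rewrite posE in qM *; move: il dE PE qM; rewrite -/M.
move: (halfrun (level j)) (cnum _ _ (position j y 0)) (cprod _ (position j y 0)).
rewrite /affine.
move: (position j y 0 + i.+1)%N (cantor_point u) => n x l X P il dE PE qM /andP[xl xu].
clearbody M; clear sp posE i2 yN.
pose tau : R := (P * M ^ l)%N%:R * x - (X * M ^ l + y)%N%:R.
have tau01 : 0 < tau < 1 by rewrite subr_gt0 xl ltrBlDl xu.
have lE : (M ^ l = M ^ i.+1 * M ^ (l - i.+1))%N by rewrite -expnD subnKC // ltnW.
have yt : y%:R + tau = (M ^ (l - i.+1))%N%:R *
   (P%:R * (M ^ i.+1)%N%:R * x - X%:R * (M ^ i.+1)%N%:R).
  by rewrite /tau lE natrD !natrM; ring.
clearbody tau.
move: dE; set h := (b * (M %/ `|a|) * M ^ (l - i.+2))%N.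
have hE : h = (b * (M %/ `|a|) * M ^ (l - i.+2))%N by [].
clearbody h; move=> dE.
have A0 : (0 < `|a|)%N by rewrite absz_gt0.
have M0 : (0 < M)%N by apply: leq_trans M2.
have aE : M = (M %/ `|a| * `|a|)%N by rewrite divnK.
have h0 : (0 < h)%N.
  by rewrite hE !muln_gt0 b0 expn_gt0 M0 andbT divn_gt0 // dvdn_leq.
have ahE : (`|a| * h = b * M ^ (l - i.+1))%N.
  rewrite (_ : (l - i.+1 = (l - i.+2).+1)%N); last by rewrite subnSK.
  by rewrite hE expnS {3}aE mulnCA -!mulnA; congr (_ * _)%N; rewrite mulnCA mulnA.
have bE : M = (b * (M %/ b))%N by rewrite mulnC divnK.
(* The hypothesis [0 < i] leaves two factors [M] in [M ^ i.+1]: one is divided by [b], the other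
   makes the integer part a multiple of [M]. *)
have iE : i = i.-1.+1 by rewrite prednK.
rewrite iE in yt PE ahE.
have := scaled_affineE e b0 h0 bE (intr_sign_absz a) ahE yt.
rewrite -PE; set J : int := (_ * _ * _ * _) => key.
have [J' JE] : exists J', J = J' * M%:Z by eexists; reflexivity.
clearbody J.
have dM : (d < M)%N by rewrite dE ltn_mod.
have yh : (y %/ h = y %/ h %/ M * M + d)%N by rewrite dE; exact: divn_eq.
have fl := f_equal (@Num.floor R) key.
rewrite floorDzr ?intr_int // intrKfloor in fl.
case: ifP fl => a1.
  have /andP[t0 t1] := tau01.
  rewrite mul1r floor_add_divn ?(ltW t0) //.
  move=> fl; apply: (@cdigit_unique _ _ _ _ (J' + ((y %/ h) %/ M)%N%:Z)).
    by rewrite fl qM {1}yh JE PoszD PoszM; ring.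
  by rewrite qM.
(* For [a < 0] the floor is [- (y %/ h) - 1], whose last digit in base [M] is the complement
   [M - 1 - d]. *)
rewrite mulN1r floor_opp_add_divn // => fl.
apply: (@cdigit_unique _ _ _ _ (J' - ((y %/ h) %/ M)%N%:Z - 1)).
  rewrite fl qM {1}yh JE PoszD PoszM -subnDA add1n -subzn // -addn1 PoszD.
  by ring.
by rewrite qM -subnDA ltn_subrL M0.
Qed.

(** * Behaviour of the affine images on free positions *)

Lemma free_digit_aux (a e : int) (b L M E Q X P : nat) (x : R) :
  a != 0 -> (0 < b)%N -> (2 <= M)%N -> (b * L <= M)%N -> (2 * `|a| <= M)%N ->
  (M <= E)%N -> (M * E.+1 <= Q)%N ->
  (X * Q + E)%N%:R < (P * Q)%N%:R * x < (X * Q + E)%N%:R + 1 ->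
  exists H : int, exists beta : R,
    [/\ (P * Q)%N%:R * ((a%:~R * x + e%:~R) / b%:R) = H%:~R * Q%:R + beta,
        L%:R <= beta & beta < Q%:R].
Proof.
move=> a0 b0 M2 bL aM EL Eq /andP[xl xu].
pose tau : R := (P * Q)%N%:R * x - (X * Q + E)%N%:R.
have t0 : 0 < tau by rewrite subr_gt0.
have t1 : tau < 1 by rewrite ltrBlDl.
pose H : int := a * X%:Z + e * P%:Z.
have bR : (0 : R) < b%:R by rewrite ltr0n.
have bneq : (b%:R : R) != 0 by rewrite gt_eqF.
(* Since [|a| * (E + tau)] lies between [b * L] and [Q / 2], reducing [H] modulo [b] leaves a
   remainder in the required range. *)
have PE : (P * Q)%N%:R * ((a%:~R * x + e%:~R) / b%:R) =
    (H%:~R * Q%:R + a%:~R * (E%:R + tau)) / b%:R.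
  rewrite /tau /H !natrD !natrM intrD !intrM -!pmulrn.
  by field.
have AE : (2 * `|a| * E.+1 <= Q)%N by apply: leq_trans Eq; rewrite leq_mul2r aM orbT.
have bLQ : (2 * (b * L) <= Q)%N.
  by apply: leq_trans Eq; apply: leq_mul => //; apply: leq_trans bL _; apply: leqW.
have AER : 2 * `|a|%N%:R * (E%:R + 1) <= Q%:R :> R.
  by rewrite natr1 -!natrM ler_nat.
have bLR : 2 * (b%:R * L%:R) <= Q%:R :> R by rewrite -!natrM ler_nat.
have ELR : b%:R * L%:R <= E%:R :> R by rewrite -!natrM ler_nat; apply: leq_trans EL.
have A1 : 1 <= `|a|%N%:R :> R by rewrite ler1n absz_gt0.
have b0Z : 0 < b%:Z by [].
have bnZ : b%:Z != 0 by rewrite gt_eqF.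
have aE := intr_sign_absz a.
have E0 : 0 <= E%:R :> R by [].
have Q0 : 0 <= Q%:R :> R by [].
rewrite PE; clearbody tau H; clear PE xl xu EL Eq M2 aM bL AE bLQ.
move: aE A1 AER bLR ELR E0 Q0.
move: (`|a|%N%:R : R) (a%:~R : R) (E%:R : R) (Q%:R : R) => A aR ER QR.
have mod_bounds (Z : int) : exists2 c : R, 0 <= c <= b%:R - 1 &
    Z%:~R = (Z %/ b%:Z)%Z%:~R * b%:R + c.
  exists ((Z %% b%:Z)%Z)%:~R; last by rewrite {1}(divz_eq Z b%:Z) intrD intrM.
  rewrite ler0z modz_ge0 //= lerBrDr -[1]/(1%:~R) -intrD pmulrn ler_int.
  by rewrite lezD1 ltz_pmod.
case: (ltgtP 0 a) a0 => // a1 _ aE A1 AER bLR ELR E0 Q0.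
  have [c /andP[c0 cb] HE] := mod_bounds H.
  have cQ0 : 0 <= c * QR by apply: mulr_ge0.
  have AE0 : 0 <= (A - 1) * (ER + tau) by apply: mulr_ge0; lra.
  have At0 : 0 <= A * (1 - tau) by apply: mulr_ge0; lra.
  have AE1 : 0 < A * (ER + 1) by apply: mulr_gt0; lra.
  have bc : 0 <= (b%:R - 1 - c) * QR by apply: mulr_ge0; lra.
  exists (H %/ b%:Z)%Z, ((c * QR + aR * (ER + tau)) / b%:R); split.
  - by rewrite HE; field.
  - by rewrite ler_pdivlMr // mulrC aE; lra.
  - by rewrite ltr_pdivrMr // aE; lra.
(* A negative [a] borrows one [Q] from the integer part, hence the division of [H - 1] and the term
   [c + 1] in the remainder. *)
have [c /andP[c0 cb]] := mod_bounds (H - 1).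
rewrite intrB => HE.
have cQ0 : 0 <= c * QR by apply: mulr_ge0.
have At0 : 0 <= A * (1 - tau) by apply: mulr_ge0; lra.
have AE1 : 0 < A * (ER + tau) by apply: mulr_gt0; lra.
have bc : 0 <= (b%:R - 1 - c) * QR by apply: mulr_ge0; lra.
exists ((H - 1) %/ b%:Z)%Z, (((c + 1) * QR + aR * (ER + tau)) / b%:R); split.
- have -> : H%:~R = ((H - 1) %/ b%:Z)%Z%:~R * b%:R + c + 1 :> R.
    by rewrite -HE /= subrK.
  by field.
- by rewrite ler_pdivlMr // mulrC aE; lra.
- by rewrite ltr_pdivrMr // aE; lra.
Qed.

Lemma free_digit_ge u (a e : int) (b p L : nat) :
  a != 0 -> (0 < b)%N -> ~~ special p ->
  (b * L <= modulus (plevel p))%N -> (2 * `|a| <= modulus (plevel p))%N ->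
  (L <= cdigit qseq (affine u a e b) p.+1)%N.
Proof.
move=> a0 b0 Sp bL aM.
have EL : (modulus (plevel p) <= pdigit u p.+1)%N.
  by rewrite pdigit_free // leq_pmulr.
have := point_bounds u p.+1; rewrite [cnum _ _ _]/= cprodS.
case/(free_digit_aux e a0 b0 (modulus_ge2 _) bL aM EL (pdigit_free_le u Sp)).
move=> H [beta [zE Lb bQ]].
by apply: (cdigit_ge _ Lb bQ); rewrite cprodS; exact: zE.
Qed.

(** After the free position [p] the numerator [X] and the denominator [P] of the truncated point are
    both divisible by [b], so the truncated part contributes an integer. The free digit at the next
    position makes the tail [T] smaller than [1 / M], so the orbit is within [1 / 8] of an
    integer. *)
Lemma free_fract u (a e : int) (b p : nat) :
  (0 < b)%N -> ~~ special p -> ~~ special p.+1 ->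
  (b %| modulus (plevel p))%N -> (8 * `|a| <= modulus (plevel p.+1))%N ->
  ~~ (1 / 8 <= fract (cantor_T qseq p.+1 (affine u a e b)) < 7 / 8).
Proof.
move=> b0 S1 S2 bM aM.
have Mq := modulus_dvd_qseq p.
have bq : (b %| qseq p.+1)%N := dvdn_trans bM Mq.
have := point_bounds u p.+2.
set x := cantor_point u; rewrite [cnum _ _ _]/= -/(cnum qseq (pdigit u) p.+1) cprodS.
have EM : (modulus (plevel p.+1) * (pdigit u p.+2).+1 <= qseq p.+2)%N.
  exact: pdigit_free_le.
move: EM aM; set M := modulus _; set E := pdigit _ p.+2; set Q := qseq p.+2.
set X := cnum qseq _ p.+1; set P := cprod _ _ => EM aM /andP[xl xu].
have bX : (b %| X)%N.
  rewrite /X /=; apply: dvdn_add; first by rewrite dvdn_mull.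
  by rewrite pdigit_free // dvdn_mulr.
have bP : (b %| P)%N by rewrite /P cprodS dvdn_mull.
have [X' XE] := dvdnP bX; have [P' PE] := dvdnP bP.
have bR : (0 : R) < b%:R by rewrite ltr0n.
have b1 : (1 : R) <= b%:R by rewrite ler1n.
have QR : (0 : R) < Q%:R by rewrite ltr0n qseq_gt0.
have E0 : (0 : R) <= E%:R by [].
pose T : R := P%:R * x - X%:R.
have TQ0 : 0 < T * Q%:R.
  by move: xl; rewrite natrD !natrM /T mulrBl; lra.
have TQ1 : T * Q%:R < E%:R + 1.
  by move: xu; rewrite natrD !natrM /T mulrBl; lra.
have T0 : 0 < T by rewrite pmulr_lgt0 in TQ0.
have TA : 8 * `|a|%N%:R * T < 1.
  have : (8 * `|a|%N%:R) * (T * Q%:R) < Q%:R.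
    have A0 : (0 : R) <= 8 * `|a|%N%:R by apply: mulr_ge0.
    apply: le_lt_trans (_ : (M%:R * (T * Q%:R)) < _).
      by apply: ler_wpM2r; [exact: ltW|rewrite -natrM ler_nat].
    have M0 : (0 : R) < M%:R by rewrite ltr0n; apply: leq_trans (modulus_ge2 _).
    apply: lt_le_trans (_ : M%:R * (E%:R + 1) <= _); first by rewrite ltr_pM2l.
    by rewrite natr1 -natrM ler_nat.
  by rewrite mulrA -[ltRHS]mul1r ltr_pM2r.
pose th : R := a%:~R * T / b%:R.
have thb : `|th| < 1 / 8.
  rewrite /th normrM normfV (gtr0_norm bR) normrM (gtr0_norm T0).
  rewrite ltr_pdivrMr //.
  have -> : `|a%:~R| = `|a|%N%:R :> R by rewrite -intr_norm -abszE.
  by lra.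
have zE : (cprod qseq p.+1)%:R * affine u a e b =
    (a * X'%:Z + e * P'%:Z)%:~R + th.
  rewrite -/P /affine -/x /th /T intrD !intrM XE PE !natrM -!pmulrn.
  by field; rewrite gt_eqF.
have fr (w : R) (I : int) (t : R) : w = I%:~R + t -> 0 <= t < 1 -> fract w = t.
  by move=> -> /andP[t0 t1]; rewrite /fract (@floor_unique _ _ I); lra.
rewrite /cantor_T -/(cprod qseq p.+1).
move: thb; rewrite ltr_norml => /andP[th1 th2].
case: (leP 0 th) => thp.
  have -> : fract ((cprod qseq p.+1)%:R * affine u a e b) = th.
    by apply: (fr _ _ _ zE); lra.
  rewrite (fr th 0 th); [|by rewrite add0r|by lra].
  by apply/negP => /andP[]; lra.
have -> : fract ((cprod qseq p.+1)%:R * affine u a e b) = 1 + th.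
  apply: (fr _ (a * X'%:Z + e * P'%:Z - 1)); last by lra.
  by rewrite zE intrB; lra.
rewrite (fr (1 + th) 0 (1 + th)); [|by rewrite add0r|by lra].
by apply/negP => /andP[]; lra.
Qed.

End Points.

(** * Normality *)

Section Passes.
Variable R : realType.
Implicit Types (c w : nat -> R).

Lemma sumr_cst_nat (x : R) m n : \sum_(m <= i < n) x = (n - m)%N%:R * x.
Proof. by rewrite big_const_nat iter_addr_0 mulr_natl. Qed.

Lemma psum_nondecreasing w m n : (forall p, 0 <= w p) -> (m <= n)%N ->
  \sum_(0 <= p < m) w p <= \sum_(0 <= p < n) w p.
Proof.
move=> w0 mn; rewrite (big_cat_nat (n := m) (p := n)) //= lerDl.
by apply: sumr_ge0.
Qed.

Lemma psum_startS w j : \sum_(0 <= p < start j.+1) w p =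
  \sum_(0 <= p < start j) w p + \sum_(start j <= p < start j.+1) w p.
Proof. by rewrite -big_cat_nat //= ltnW // start_ltS. Qed.

(** At the ends of passes the errors add up to a small multiple of the total weight plus a constant,
    and the weight diverges. Inside a pass both sums are monotone and the whole pass has negligible
    weight. *)
Lemma psum_equiv_of_passes c w :
  (forall p, 0 <= c p) -> (forall p, 0 <= w p) ->
  (forall eps : R, 0 < eps -> exists j0, forall j, (j0 <= j)%N ->
     `|\sum_(start j <= p < start j.+1) c p
       - \sum_(start j <= p < start j.+1) w p|
     <= eps * \sum_(start j <= p < start j.+1) w p) ->
  (forall eps : R, 0 < eps -> exists j0, forall j, (j0 <= j)%N ->
     \sum_(start j <= p < start j.+1) w p
     <= eps * \sum_(0 <= p < start j) w p) ->
  (forall A : R, exists j0, forall j, (j0 <= j)%N ->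
     A <= \sum_(0 <= p < start j) w p) ->
  forall eps : R, 0 < eps -> exists n0, forall n, (n0 <= n)%N ->
    `|\sum_(0 <= p < n) c p - \sum_(0 <= p < n) w p|
    <= eps * \sum_(0 <= p < n) w p.
Proof.
move=> c0 w0 H1 H2 H3 eps e0.
(* The divisor 8 leaves room for the initial error, the accumulated error and the unfinished
   pass. *)
pose eta : R := Num.min eps 1 / 8.
have eta0 : 0 < eta by rewrite divr_gt0 // lt_min e0 ltr01.
have eta1 : eta <= 1 / 8 by rewrite ler_pM2r // ge_min lexx orbT.
have eta2 : 8 * eta <= eps.
  by rewrite /eta mulrC divfK // ge_min lexx.
clearbody eta.
have [j1 Hj1] := H1 _ eta0; have [j3 Hj3] := H2 _ eta0.
(* The error made before passes become accurate; it is absorbed once the total weight exceeds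
   [K / eta]. *)
pose K : R := `|\sum_(0 <= p < start j1) c p - \sum_(0 <= p < start j1) w p|.
have [j2 Hj2] := H3 (K / eta).
have bd j : (j1 <= j)%N ->
    `|\sum_(0 <= p < start j) c p - \sum_(0 <= p < start j) w p|
    <= K + eta * (\sum_(0 <= p < start j) w p).
  elim: j => [|j IH].
    by rewrite leqn0 => /eqP j10; rewrite /K j10 start0 !big_geq // mulr0 addr0.
  rewrite leq_eqVlt => /predU1P[<-|].
    by rewrite lerDl; apply: mulr_ge0; [exact: ltW|exact: sumr_ge0].
  rewrite ltnS => jj; have := IH jj; have := Hj1 _ jj; rewrite !psum_startS.
  move: (\sum_(0 <= p < _) c p) (\sum_(0 <= p < _) w p)
        (\sum_(start _ <= p < _) c p) (\sum_(start _ <= p < _) w p).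
  move=> C W C' W'; rewrite !ler_norml => /andP[h1 h2] /andP[h3 h4].
  by apply/andP; split; lra.
pose J := maxn j1 (maxn j2 j3).
exists (start J) => n Jn.
have /andP[jn nj] := passP n.
have Jj : (J <= pass n)%N.
  rewrite leqNgt; apply/negP => lt; have := start_le lt; lia.
move: Jj; rewrite !geq_max => /and3P[jj1 jj2 jj3].
have h1 := bd _ jj1; have h2 := bd _ (leqW jj1).
have h3 := Hj3 _ jj3; have h4 := Hj2 _ jj2.
have h5 := psum_nondecreasing w0 jn; have h6 := psum_nondecreasing w0 (ltnW nj).
have h7 := psum_nondecreasing c0 jn; have h8 := psum_nondecreasing c0 (ltnW nj).
have : 0 <= \sum_(0 <= p < start (pass n)) w p by apply: sumr_ge0.
move: h1 h2 h3 h4 h5 h6 h7 h8; rewrite !(psum_startS w).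
rewrite ler_pdivrMr //.
move: (\sum_(0 <= p < start (pass n).+1) c p).
clear bd Hj2; clearbody K.
move: (\sum_(0 <= p < start (pass n)) c p) (\sum_(0 <= p < start (pass n)) w p)
      (\sum_(0 <= p < n) c p) (\sum_(0 <= p < n) w p)
      (\sum_(start (pass n) <= p < start (pass n).+1) w p).
move=> C W Cn Wn V C2; rewrite !ler_norml.
move=> /andP[h1 h2] /andP[h3 h4] h5 h6 h7 h8 h9 h10 W0.
have hV : eta * V <= eta * (eta * W) by rewrite ler_pM2l.
have hW : eta * (eta * W) <= 1 / 8 * (eta * W).
  by rewrite ler_wpM2r // mulr_ge0 // ltW.
have hWn : eta * W <= eta * Wn by rewrite ler_pM2l.
have hWn' : 8 * (eta * Wn) <= eps * Wn.
  by rewrite mulrA ler_wpM2r //; lra.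
have eW : 0 <= eta * W by rewrite mulr_ge0 // ltW.
by apply/andP; split; lra.
Qed.

End Passes.

(** * Occurrences of blocks *)

Definition block_at (F : nat -> nat) (k : nat) (B : k.-tuple nat) (p : nat) : bool :=
  [seq F j | j <- iota p.+1 k] == B.

Lemma block_atE F k (B : k.-tuple nat) p :
  block_at F B p = all (fun t => F (p + t).+1 == nth 0%N B t) (iota 0 k).
Proof.
rewrite /block_at -[X in iota X _]addn0 iotaDl -map_comp.
apply/eqP/allP => [E t|H].
  rewrite mem_iota add0n => /= tk.
  have := f_equal (fun s => nth 0%N s t) E.
  rewrite (nth_map 0%N) ?size_iota // nth_iota // => <- /=.
  by rewrite add0n addSn.
apply: (@eq_from_nth _ 0%N); first by rewrite size_map size_iota size_tuple.
rewrite size_map size_iota => t tk.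
rewrite (nth_map 0%N) ?size_iota // nth_iota //= add0n addSn.
by apply/eqP/H; rewrite mem_iota.
Qed.

Lemma block_countE F k (B : k.-tuple nat) n :
  block_count F B n =
  (\sum_(0 <= p < n) ((p + k <= n) && block_at F B p))%N.
Proof.
rewrite /block_count -[X in iota X n]addn0 iotaDl count_map -sum1_count.
rewrite big_mkcond /= /index_iota subn0; apply: eq_bigr => p _.
by rewrite add1n addSn ltnS /block_at; case: (_ && _).
Qed.

(** Only the last [k] starting places can overrun [n]. Dropping the condition that the block fits
    makes the count additive over passes. *)
Lemma block_count_bounds F k (B : k.-tuple nat) n :
  (block_count F B n <= \sum_(0 <= p < n) block_at F B p
                     <= block_count F B n + k)%N.
Proof.
rewrite block_countE; apply/andP; split.
  by apply: leq_sum => p _; case: (p + k <= n)%N.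
apply: (@leq_trans (\sum_(0 <= p < n) ((p + k <= n) && block_at F B p)
                    + \sum_(0 <= p < n) (n < p + k))%N).
  rewrite -big_split; apply: leq_sum => p _ /=; rewrite ltnNge.
  by case: (p + k <= n)%N; case: (block_at F B p).
rewrite leq_add2l (big_cat_nat (n := (n - k)%N)) ?leq_subr //=.
rewrite big_nat big1 => [|p /andP[_ pn]]; last first.
  by have -> : (n < p + k)%N = false by lia.
rewrite add0n; apply: leq_trans (_ : \sum_(n - k <= p < n) 1 <= _)%N.
  by apply: leq_sum => p _; case: (_ < _)%N.
by rewrite sum_nat_const_nat; lia.
Qed.

Section Normality.
Variable R : realType.
Implicit Types (u : R).

Definition weight (k p : nat) : R := (\prod_(p.+1 <= i < p.+1 + k) qseq i)%:R^-1.

Lemma QnkE k n : Qnk R qseq k n = \sum_(0 <= p < n) weight k p.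
Proof. by rewrite /Qnk big_add1. Qed.

Lemma prodn_qseq_gt0 m n : (0 < \prod_(m <= i < n) qseq i)%N.
Proof. by rewrite prodn_gt0 // => i; exact: qseq_gt0. Qed.

Lemma weight_ge0 k p : 0 <= weight k p.
Proof. by rewrite invr_ge0. Qed.

Lemma weight_le1 k p : weight k p <= 1.
Proof. by rewrite invf_le1 ?ltr0n ?ler1n ?prodn_qseq_gt0. Qed.

Lemma weight_le_inv k p : (0 < k)%N -> weight k p <= (qseq p.+1)%:R^-1.
Proof.
move=> k0; rewrite lef_pV2 ?posrE ?ltr0n ?qseq_gt0 ?prodn_qseq_gt0 // ler_nat.
by rewrite big_ltn ?leq_pmulr ?prodn_qseq_gt0 //; lia.
Qed.

Lemma weight_special k j y i : (y < nruns (level j))%N ->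
  (i + k <= halfrun (level j))%N ->
  weight k (position j y i) = (modulus (level j) ^ k)%N%:R^-1.
Proof.
move=> yN ik; rewrite /weight; congr (_%:R^-1).
elim: k ik => [|k IH] ik; first by rewrite addn0 big_geq.
rewrite addnS big_nat_recr ?leq_addr //= IH ?expnSr; last by lia.
congr (_ * _)%N; rewrite addSn positionD.
have h0 := halfrun_gt0 (level j).
by rewrite qseq_special ?plevel_position ?special_position //; lia.
Qed.

Lemma eqn_complement (M d c : nat) : (d < M)%N -> (c < M)%N ->
  (M - 1 - d == c)%N = (d == M - 1 - c)%N.
Proof. by move=> dM cM; apply/eqP/eqP; lia. Qed.

(** At a fixed place the digits of the image are, up to complement, consecutive base-[M] digits of a
    quotient of [y], and [y] takes every value below [M ^ l] once per pass; [sum_digit_block] counts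
    them. *)
Lemma sum_block_at u (a e : int) (b k j i : nat) (B : k.-tuple nat) :
  let M := modulus (level j) in
  a != 0 -> (0 < b)%N -> (`|a| %| M)%N -> (b %| M)%N ->
  (forall t, (t < k)%N -> (nth 0 B t < M)%N) ->
  (0 < i)%N -> (i + k < halfrun (level j))%N ->
  ((\sum_(0 <= y < nruns (level j))
      block_at (cdigit qseq (affine u a e b)) B (position j y i)) * M ^ k
   = nruns (level j))%N.
Proof.
move=> M a0 b0 aM bM BM i0 ik.
have M0 : (0 < M)%N by apply: leq_trans (modulus_ge2 _).
have A0 : (0 < `|a|)%N by rewrite absz_gt0.
set l := halfrun (level j) in ik *.
(* [h] is the divisor that [special_digit] attaches to the last digit of the block, and [v] is the
   cofactor of [h * M ^ k] in [M ^ l]. *)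
pose h := (b * (M %/ `|a|) * M ^ (l - i - k.+1))%N.
pose v := ((M %/ b) * `|a| * M ^ i.-1)%N.
have a'0 : (0 < M %/ `|a|)%N by rewrite divn_gt0 // dvdn_leq.
have h0 : (0 < h)%N by rewrite /h !muln_gt0 b0 a'0 expn_gt0 M0.
have NE : nruns (level j) = (v * (h * M ^ k))%N.
  have -> : nruns (level j) = (M ^ (1 + (1 + (i.-1 + ((l - i - k.+1) + k)))))%N.
    rewrite -[nruns _]/(M ^ l)%N; congr (_ ^ _)%N; lia.
  rewrite !expnD expn1 -{1}(divnK bM) -{2}(divnK aM) /v /h.
  move: (M %/ b)%N (M %/ `|a|)%N (M ^ _)%N (M ^ _)%N (M ^ _)%N => t1 t2 t3 t4 t5.
  by ring.
(* For [a < 0] the image shows [B] exactly where the quotient of [y] shows the complemented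
   block. *)
pose B' t := if 0 < a then nth 0%N B t else (M - 1 - nth 0%N B t)%N.
have B'M t : (t < k)%N -> (B' t < M)%N.
  by move=> tk; rewrite /B'; case: ifP => _; [exact: BM|lia].
have := sum_digit_block v M0 h0 B'M.
rewrite -NE => H; rewrite [RHS]NE mulnA -H; congr (_ * _)%N.
rewrite !big_nat; apply: eq_bigr => y /andP[_ yN].
rewrite block_atE; congr nat_of_bool; apply: eq_in_all => t.
rewrite mem_iota add0n => /= tk.
rewrite positionD special_digit //; [|lia|rewrite -/l; lia].
rewrite -/M -/l.
have -> : (b * (M %/ `|a|) * M ^ (l - (i + t).+2) = h * M ^ (k - t.+1))%N.
  rewrite /h -[RHS]mulnA -expnD; congr (_ * _ ^ _)%N; lia.
have := BM _ tk; rewrite /B'.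
have : ((y %/ (h * M ^ (k - t.+1))) %% M < M)%N by rewrite ltn_mod.
move: ((y %/ (h * M ^ (k - t.+1))) %% M)%N (nth 0%N B t) => d c dM cM.
by case: ifP => // _; exact: eqn_complement.
Qed.


(** The divisibilities serve the special digits and the orbit bound; the inequalities make free
    digits of the image at least [L] and keep the orbit near the integers. *)
Definition good_level (a : int) (b L m : nat) : Prop :=
  [/\ (`|a| %| modulus m)%N, (b %| modulus m)%N, (8 * `|a| <= modulus m)%N &
      (b * L <= modulus m)%N].

Lemma good_level_exists (a : int) (b L : nat) : a != 0 -> (0 < b)%N ->
  exists m0, forall m, (m0 <= m)%N -> good_level a b L m.
Proof.
move=> a0 b0; have A0 : (0 < `|a|)%N by rewrite absz_gt0.
exists (8 * `|a| + b * L + b)%N => m; move: A0; set A := `|a|%N => A0 h.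
have mM := modulus_gem m; split.
- by apply: dvdn_modulus => //; lia.
- by apply: dvdn_modulus => //; lia.
- by lia.
- by lia.
Qed.

(** Each place [i] of a run is summed over all runs. Places with [0 < i] and [i + k < l] have no
    error. Place 0 and the last [k] special places cost at most one per run each. On free places [B]
    never starts, because its first entry is below [L], and the weights add up to at most one per
    run. *)
Lemma pass_defect u (a e : int) (b k j L : nat) (B : k.-tuple nat) :
  let f p := (block_at (cdigit qseq (affine u a e b)) B p)%:R - weight k p in
  a != 0 -> (0 < b)%N -> (0 < k)%N -> good_level a b L (level j) ->
  (forall t, (t < k)%N -> (nth 0 B t < L)%N) -> (k <= level j)%N ->
  `|\sum_(start j <= p < start j.+1) f p| <= (nruns (level j))%:R * (k.+2)%:R.
Proof.
move=> f a0 b0 k0 [aM bM aM8 bL] BL km.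
have BM t : (t < k)%N -> (nth 0 B t < modulus (level j))%N.
  by move=> /BL tL; apply: leq_trans tL _; apply: leq_trans bL; rewrite leq_pmull.
rewrite sum_pass exchange_big /=.
set N := nruns (level j); set l := halfrun (level j); set M := modulus (level j).
have kl : (k.+1 < l)%N by apply: leq_trans (halfrun_gem _); rewrite ltnS.
pose D i := \sum_(0 <= y < N) f (position j y i).
have f1 p : `|f p| <= 1.
  rewrite /f; have := weight_ge0 k p; have := weight_le1 k p.
  move: (weight k p) => w w1 w0; rewrite ler_norml.
  by case: (block_at _ _ _) => /=; apply/andP; split; lra.
have D1 i : `|D i| <= N%:R.
  apply: le_trans (ler_norm_sum _ _ _) _.
  apply: le_trans (ler_sum _ (fun y _ => f1 (position j y i))) _.
  by rewrite sumr_cst_nat subn0 mulr1.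
have D0 i : (0 < i)%N -> (i + k < l)%N -> D i = 0.
  move=> i0 ik; rewrite /D sumrB -natr_sum.
  have := sum_block_at u e a0 b0 aM bM BM i0 ik; rewrite -/M -/N => H.
  rewrite [X in _ - X](eq_big_nat _ _ (F2 := fun=> (M ^ k)%N%:R^-1)); last first.
    by move=> y /andP[_ yN]; rewrite weight_special // ltnW.
  have MkR : (M ^ k)%N%:R != 0 :> R.
    by rewrite pnatr_eq0 -lt0n expn_gt0 (leq_trans _ (modulus_ge2 _)).
  have NR : N%:R = (\sum_(0 <= y < N) block_at (cdigit qseq (affine u a e b)) B
      (position j y i))%N%:R * (M ^ k)%N%:R :> R by rewrite -natrM H.
  by rewrite sumr_cst_nat subn0 NR mulfK // subrr.
have Dl i : (l <= i < 2 * l)%N -> `|D i| <= N%:R / l%:R.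
  move=> /andP[li il]; apply: le_trans (ler_norm_sum _ _ _) _.
  have -> : N%:R / l%:R = \sum_(0 <= y < N) l%:R^-1 :> R.
    by rewrite sumr_cst_nat subn0.
  rewrite !big_nat; apply: ler_sum => y /andP[_ yN].
  have Sp : ~~ special (position j y i) by rewrite special_position // -leqNgt.
  have pl : plevel (position j y i) = level j by rewrite plevel_position.
  rewrite /f.
  have -> : block_at (cdigit qseq (affine u a e b)) B (position j y i) = false.
    rewrite block_atE; apply/negbTE/allPn; exists 0%N; first by rewrite mem_iota.
    rewrite addn0; have := BL _ k0; rewrite neq_ltn => BL0.
    apply/orP; right; apply: leq_trans BL0 _.
    apply: free_digit_ge => //; rewrite pl //.
    by apply: leq_trans aM8; rewrite leq_mul2r orbT.
  rewrite sub0r normrN ger0_norm ?weight_ge0 //.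
  apply: le_trans (weight_le_inv _ k0) _.
  rewrite lef_pV2 ?posrE ?ltr0n ?qseq_gt0 ?halfrun_gt0 // ler_nat.
  by rewrite /l -pl; apply: qseq_free_ge_halfrun.
rewrite -/D (big_cat_nat (n := l)) //=; last by lia.
rewrite (big_cat_nat (n := (l - k)%N)) ?leq_subr //=.
rewrite big_ltn; last by lia.
have -> : \sum_(1 <= i < l - k) D i = 0.
  by rewrite big_nat big1 // => i /andP[i1 il]; apply: D0 => //; lia.
rewrite addr0.
have S2 : `|\sum_(l - k <= i < l) D i| <= N%:R * k%:R.
  apply: le_trans (ler_norm_sum _ _ _) _.
  apply: le_trans (ler_sum _ (fun i _ => D1 i)) _.
  by rewrite sumr_cst_nat subKn ?[k%:R * _]mulrC //; lia.
have S3 : `|\sum_(l <= i < 2 * l) D i| <= N%:R.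
  apply: le_trans (ler_norm_sum _ _ _) _.
  rewrite big_nat; apply: le_trans (ler_sum _ Dl) _.
  rewrite -big_nat sumr_cst_nat.
  have -> : (2 * l - l = l)%N by lia.
  by rewrite mulrC divfK // pnatr_eq0 -lt0n halfrun_gt0.
have S1 := D1 0%N.
apply: le_trans (ler_normD _ _) _.
apply: le_trans (lerD (ler_normD _ _) (lexx _)) _.
rewrite -[k.+2]addn2 natrD mulrDr.
move: S1 S2 S3; move: (N%:R : R) => NR; lra.
Qed.

(** In each run the first [l - k] places weigh [M ^ - k] each, and [l] is at least
    [(m + 1) * M ^ k]. *)
Lemma pass_weight_ge k j : (k <= level j)%N ->
  (nruns (level j))%:R * ((level j).+1%:R - k%:R) <=
  \sum_(start j <= p < start j.+1) weight k p.
Proof.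
move=> km; rewrite sum_pass.
set N := nruns _; set M := modulus (level j); set l := halfrun (level j).
have kl : (k < l)%N by apply: leq_trans (ltnW (halfrun_gem _)); rewrite ltnS.
have M0 : (0 < M ^ k)%N by rewrite expn_gt0 (leq_trans _ (modulus_ge2 _)).
have M0R : (0 : R) < (M ^ k)%N%:R by rewrite ltr0n.
have -> : N%:R * ((level j).+1%:R - k%:R) =
    \sum_(0 <= y < N) ((level j).+1%:R - k%:R) :> R.
  by rewrite sumr_cst_nat subn0.
rewrite !big_nat; apply: ler_sum => y /andP[_ yN].
rewrite (big_cat_nat (n := (l - k)%N)) //=; last by lia.
apply: ler_wpDr; first by apply: sumr_ge0 => i _; exact: weight_ge0.
rewrite (eq_big_nat _ _ (F2 := fun=> (M ^ k)%N%:R^-1)); last first.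
  by move=> i /andP[_ il]; rewrite weight_special //; lia.
rewrite sumr_cst_nat subn0 ler_pdivlMr //.
rewrite natrB; last by exact: ltnW.
rewrite mulrBl lerB //.
  by rewrite -natrM ler_nat halfrun_ge // leqW.
by rewrite ler_peMr // ler1n.
Qed.

Lemma pass_weight_le k j :
  \sum_(start j <= p < start j.+1) weight k p <= (passlen (level j))%:R.
Proof.
apply: le_trans (ler_sum _ (fun p _ => weight_le1 k p)) _.
by rewrite sumr_cst_nat startS addKn mulr1.
Qed.

(** Each pass of level at least [k] weighs at least 1. *)
Lemma psum_weight_ge k : exists j0, forall j,
  j%:R - j0%:R <= \sum_(0 <= p < start j) weight k p.
Proof.
have [j0 Hj0] := level_unbounded k; exists j0; elim=> [|j IH].
  by rewrite start0 big_geq // sub0r oppr_le0.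
case: (leqP j0 j) => jj; last first.
  apply: le_trans (_ : 0 <= _); last by apply: sumr_ge0 => p _; exact: weight_ge0.
  by rewrite subr_le0 ler_nat.
rewrite psum_startS -natr1; have := pass_weight_ge (Hj0 _ jj).
have : (1 : R) <= (nruns (level j))%:R * ((level j).+1%:R - k%:R).
  rewrite -[leLHS]mulr1; apply: ler_pM => //; first by rewrite ler1n nruns_gt0.
  by rewrite lerBrDl natr1 ler_nat ltnS Hj0.
lra.
Qed.

Lemma psum_weight_unbounded k (A : R) : exists j0, forall j, (j0 <= j)%N ->
  A <= \sum_(0 <= p < start j) weight k p.
Proof.
have [j0 Hj0] := psum_weight_ge k.
exists (j0 + (Num.truncn A).+1)%N => j jj; apply: le_trans (Hj0 j).
rewrite lerBrDl; apply: le_trans (_ : (j0 + (Num.truncn A).+1)%N%:R <= _).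
  by rewrite natrD lerD2l ltW // truncnS_gt.
by rewrite ler_nat.
Qed.

(** The square of the length of pass [j] is at most [j + slack], while the passes before it weigh at
    least [j - j0]: the comparison is of order [sqrt j] against [j]. *)
Lemma pass_weight_negligible k (eps : R) : 0 < eps ->
  exists j0, forall j, (j0 <= j)%N ->
    \sum_(start j <= p < start j.+1) weight k p
    <= eps * \sum_(0 <= p < start j) weight k p.
Proof.
move=> e0; have [j0 Hj0] := psum_weight_ge k.
pose K : R := eps / 2 * slack%:R + eps^-1 + eps * j0%:R.
exists (Num.truncn (2 * K / eps)).+1 => j jj.
have jK : 2 * K <= eps * j%:R.
  rewrite -ler_pdivrMl // [_^-1 * _]mulrC; apply: ltW.
  by apply: lt_le_trans (truncnS_gt _) _; rewrite ler_nat.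
apply: le_trans (pass_weight_le k j) _.
apply: le_trans (_ : eps * (j%:R - j0%:R) <= _); last by rewrite ler_pM2l.
have AA : (passlen (level j))%:R ^+ 2 <= j%:R + slack%:R :> R.
  by rewrite -natrX -natrD ler_nat passlen_level.
move: AA; set A : R := (passlen _)%:R => AA.
(* AM-GM: [A <= eps A^2 / 2 + 1 / eps] *)
have amgm : A <= eps / 2 * A ^+ 2 + eps^-1.
  have h : 0 <= (eps * A - 1) ^+ 2 by apply: sqr_ge0.
  rewrite -(ler_pM2l e0) mulrDr mulfV ?gt_eqF //; nra.
have : eps / 2 * A ^+ 2 <= eps / 2 * (j%:R + slack%:R).
  by rewrite ler_pM2l // divr_gt0.
move: jK amgm; rewrite /K; move: (eps^-1) => ei; lra.
Qed.

Lemma normal_affine u (a e : int) (b k : nat) :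
  a != 0 -> (0 < b)%N -> (0 < k)%N -> normal_of_order qseq k (affine u a e b).
Proof.
move=> a0 b0 k0; set z := affine u a e b.
exists (Num.floor z), (cdigit qseq z); split.
  exact: cantor_expansion_cdigit qseq_ge2.
move=> B; apply/cvg_nat_epsP => eps e0.
(* Above every entry of [B], so that on late passes no occurrence of [B] starts at a free
   position. *)
pose L := (\max_(t < k) nth 0%N B t).+1.
have BL t : (t < k)%N -> (nth 0 B t < L)%N.
  by move=> tk; rewrite ltnS (leq_bigmax (Ordinal tk)).
have [m0 Hm0] := good_level_exists L a0 b0.
pose c p : R := (block_at (cdigit qseq z) B p)%:R.
have [n0 Hn0] : exists n0, forall n, (n0 <= n)%N ->
    `|\sum_(0 <= p < n) c p - \sum_(0 <= p < n) weight k p|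
    <= eps / 2 * \sum_(0 <= p < n) weight k p.
  apply: psum_equiv_of_passes; last by rewrite divr_gt0.
  - by move=> p; rewrite ler0n.
  - exact: weight_ge0.
  (* Beyond this level the error [k.+2] per run is at most [eta] times the guaranteed weight
     [m.+1 - k] per run. *)
  - move=> eta eta0; pose T := (Num.truncn (k.+2%:R / eta)).+1.
    have [j0 Hj0] := level_unbounded (m0 + k + T); exists j0 => j /Hj0 jl.
    rewrite -sumrB.
    have gl : good_level a b L (level j) by apply: Hm0; lia.
    apply: le_trans (pass_defect u e a0 b0 k0 gl BL _) _; first by lia.
    apply: le_trans (_ : eta * ((nruns (level j))%:R * ((level j).+1%:R - k%:R)) <= _).
      rewrite mulrCA ler_pM2l ?ltr0n ?nruns_gt0 //.
      rewrite -ler_pdivrMl // [_^-1 * _]mulrC; apply: le_trans (ltW (truncnS_gt _)) _.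
      by rewrite lerBrDl -natrD ler_nat -/T; lia.
    by rewrite ler_pM2l // pass_weight_ge //; lia.
  - by move=> eta; exact: pass_weight_negligible.
  - by move=> A; exact: psum_weight_unbounded.
(* From this weight on, the at most [k] overrunning blocks cost a relative error of at most
   [eps / 2]. *)
have [j1 Hj1] := psum_weight_unbounded k (2 * k%:R / eps + 1).
exists (maxn n0 (start j1)) => n; rewrite geq_max => /andP[nn0 nj1].
have h1 := Hn0 _ nn0.
have h2 := le_trans (Hj1 _ (leqnn _)) (psum_nondecreasing (weight_ge0 k) nj1).
have /andP[h3 h4] := block_count_bounds (cdigit qseq z) B n.
rewrite QnkE.
have cE : \sum_(0 <= p < n) c p =
    (\sum_(0 <= p < n) block_at (cdigit qseq z) B p)%N%:R by rewrite natr_sum.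
rewrite cE in h1.
have h3R : (block_count (cdigit qseq z) B n)%:R <=
  (\sum_(0 <= p < n) block_at (cdigit qseq z) B p)%N%:R :> R by rewrite ler_nat.
have h4R : (\sum_(0 <= p < n) block_at (cdigit qseq z) B p)%N%:R <=
  (block_count (cdigit qseq z) B n)%:R + k%:R :> R by rewrite -natrD ler_nat.
have W0 : 0 < \sum_(0 <= p < n) weight k p.
  apply: lt_le_trans h2; rewrite ltr_wpDl // divr_ge0 ?mulr_ge0 //.
  exact: ltW.
move: h1 h2 h3R h4R W0.
move: (\sum_(0 <= p < n) weight k p) ((block_count _ _ _)%:R : R)
  ((\sum_(0 <= p < n) _)%N%:R : R) => W N C h1 h2 h3R h4R W0.
have -> : N / W - 1 = (N - W) / W by rewrite mulrBl divff // gt_eqF.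
rewrite normrM normfV (gtr0_norm W0) ler_pdivrMr //.
have h5 : k%:R <= eps / 2 * W.
  rewrite -ler_pdivrMl ?divr_gt0 //; apply: le_trans h2.
  by rewrite invf_div mulrAC ler_wpDr.
move: h1; rewrite !ler_norml => /andP[h6 h7].
have k0R : 0 <= k%:R :> R by [].
by apply/andP; split; lra.
Qed.

End Normality.

(** * Failure of distribution normality *)

Section NotDistNormal.
Variable R : realType.
Implicit Types (u : R).

Lemma count_iota0 (g : pred nat) N :
  count g (iota 0 N) = (\sum_(0 <= p < N) g p)%N.
Proof.
rewrite -sum1_count big_mkcond /= /index_iota subn0; apply: eq_bigr => p _.
by case: (g p).
Qed.

(** In a run only the [l] special places and the last free one, whose successor is special or lies
    in another run, can be central. Level at least 1 gives [3 <= l], so these [l + 1] places are at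
    most two thirds of [2 * l]. *)
Lemma pass_central_count u (a e : int) (b j : nat) :
  (0 < b)%N -> (b %| modulus (level j))%N -> (8 * `|a| <= modulus (level j))%N ->
  (0 < level j)%N ->
  (3 * \sum_(start j <= p < start j.+1)
     (1 / 8 <= fract (cantor_T qseq p.+1 (affine u a e b)) < 7 / 8)%R
   <= 2 * passlen (level j))%N.
Proof.
move=> b0 bM aM lv; rewrite sum_pass.
set N := nruns _; set l := halfrun _.
have l3 : (3 <= l)%N by apply: leq_trans (halfrun_gem _); rewrite ltnS.
have -> : passlen (level j) = (N * (2 * l))%N by [].
have : (\sum_(0 <= y < N) \sum_(0 <= i < 2 * l)
    (1 / 8 <= fract (cantor_T qseq (position j y i).+1 (affine u a e b)) < 7 / 8)%R
    <= \sum_(0 <= y < N) l.+1)%N.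
  rewrite !big_nat; apply: leq_sum => y /andP[_ yN].
  rewrite (big_cat_nat (n := l)) //=; last by lia.
  rewrite (big_cat_nat (m := l) (n := (2 * l).-1)) //=; try by lia.
  rewrite [X in (_ + (X + _))%N]big_nat [X in (_ + (X + _))%N]big1; last first.
    move=> i /andP[li il].
    have i2 : (i < 2 * l)%N by lia.
    have i3 : (i.+1 < 2 * l)%N by lia.
    have SE : (position j y i).+1 = position j y i.+1.
      by rewrite -addn1 positionD addn1.
    apply/eqP; rewrite eqb0; apply: free_fract => //.
    - by rewrite special_position // -leqNgt.
    - by rewrite SE special_position // -leqNgt ltnW.
    - by rewrite plevel_position.
    - by rewrite SE plevel_position.
  rewrite add0n -[l.+1]addn1; apply: leq_add.
    apply: leq_trans (_ : \sum_(0 <= i < l) 1 <= _)%N.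
      by apply: leq_sum => i _; case: (_ <= _ < _).
    by rewrite sum_nat_const_nat subn0 muln1.
  have -> : (2 * l = (2 * l).-1.+1)%N by lia.
  by rewrite /= big_nat1; case: (_ <= _ < _).
rewrite sum_nat_const_nat subn0; set S := (\sum_(0 <= y < N) _)%N.
clearbody S N l => h; nia.
Qed.

Lemma not_dist_normal_affine u (a e : int) (b : nat) :
  a != 0 -> (0 < b)%N -> ~ dist_normal_set qseq (affine u a e b).
Proof.
move=> a0 b0 /(_ (1 / 8) (7 / 8) ltac:(lra) ltac:(lra) ltac:(lra)).
(* Uniform distribution would give frequency [3 / 4], while late passes allow at most [2 / 3];
   [1 / 24] is half the gap. *)
move=> /cvg_nat_epsP /(_ (1 / 24) ltac:(lra)) [N0 HN0].
pose g n : bool := 1 / 8 <= fract (cantor_T qseq n (affine u a e b)) < 7 / 8.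
have [m0 Hm0] := good_level_exists 0 a0 b0.
have [j0 Hj0] := level_unbounded m0.+1.
have bd j : (j0 <= j)%N ->
    (3 * \sum_(0 <= p < start j) g p.+1 <= 3 * start j0 + 2 * start j)%N.
  elim: j => [|j IH]; first by rewrite start0 big_geq // muln0.
  rewrite leq_eqVlt => /predU1P[<-|].
    apply: leq_trans (leq_addr _ _); rewrite leq_mul2l /=.
    apply: leq_trans (_ : \sum_(0 <= p < start j0) 1 <= _)%N.
      by apply: leq_sum => p _; case: (g _).
    by rewrite sum_nat_const_nat subn0 muln1.
  rewrite ltnS => jj; have lj := Hj0 _ jj.
  have [_ bM aM8 _] := Hm0 (level j) (ltnW lj).
  rewrite (big_cat_nat (n := start j)) //=; last exact: ltnW (start_ltS j).
  have := pass_central_count u e b0 bM aM8 (leq_ltn_trans (leq0n _) lj).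
  have := IH jj; rewrite startS -/g.
  set A := (\sum_(0 <= p < _) _)%N; set B := (\sum_(start j <= p < _) _)%N.
  clearbody A B; lia.
(* The early passes then have relative size below [1 / 24]. One is added to [start j] below because
   position [p] governs the orbit term of index [p.+1], and term 0 is counted apart. *)
pose j := (j0 + N0 + 24 * (start j0).+1)%N.
have nj := start_ge j; pose n := (start j).+1.
have := HN0 n ltac:(rewrite /n; lia).
rewrite (_ : count _ _ = \sum_(0 <= p < n) g p)%N; last by rewrite -count_iota0.
have : (3 * \sum_(0 <= p < n) g p <= 3 * (start j0).+1 + 2 * n)%N.
  rewrite /n big_nat_recl //=.
  have := bd j ltac:(rewrite /j; lia).
  case: (g 0%N) => /=; set S := (\sum_(0 <= i < _) _)%N; clearbody S; lia.
set S := (\sum_(0 <= i < _) _)%N.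
have nbig : (24 * (start j0).+1 < n)%N by rewrite /n; move: nj; rewrite {1}/j; lia.
clearbody S n => h.
have hR : 3 * S%:R <= 3 * (start j0).+1%:R + 2 * n%:R :> R.
  by rewrite -!natrM -natrD ler_nat.
have nR : 24 * (start j0).+1%:R < n%:R :> R by rewrite -natrM ltr_nat.
have n0 : 0 < n%:R :> R by rewrite ltr0n; lia.
rewrite ler_norml => /andP[h1 _].
have h2 : 7 / 8 - 1 / 8 - 1 / 24 <= S%:R / n%:R :> R by lra.
rewrite ler_pdivlMr // in h2.
lra.
Qed.

Lemma point_itv u : 0 < cantor_point u < 1.
Proof. by have := point_bounds u 0; rewrite cprod0 mul1r /= add0r. Qed.

Lemma point_in_U u : U_set qseq (cantor_point u).
Proof.
have /andP[x0 x1] := point_itv u.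
split.
  exists (cdigit qseq (cantor_point u)).
  have <- : Num.floor (cantor_point u) = 0.
    by apply: floor_unique; rewrite ?add0r // ltW.
  exact: cantor_expansion_cdigit qseq_ge2.
move=> r s r0.
have E : ratr r * cantor_point u + ratr s =
    affine u (numq r * denq s) (numq s * denq r) (absz (denq r * denq s)).
  rewrite /affine /ratr !intrM.
  rewrite pmulrn gtz0_abs ?mulr_gt0 ?denq_gt0 // intrM.
  have d1 : (denq r)%:~R != 0 :> R by rewrite intr_eq0 denq_neq0.
  have d2 : (denq s)%:~R != 0 :> R by rewrite intr_eq0 denq_neq0.
  by field; rewrite d1 d2.
have a0 : numq r * denq s != 0 by rewrite mulf_neq0 ?numq_eq0 ?denq_neq0.
have b0 : (0 < absz (denq r * denq s)%R)%N.
  by rewrite absz_gt0 mulf_neq0 ?denq_neq0.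
split; rewrite E; last exact: not_dist_normal_affine.
by move=> k k0; apply: normal_affine.
Qed.

End NotDistNormal.

(** * Inverse Hoelder continuity of the parametrisation *)

Lemma cprod_qseq n :
  cprod qseq n = (cprod branching n * cprod residual n)%N.
Proof. by rewrite /cprod -big_split. Qed.

Lemma residual_le p : (residual p.+1 <= 2 ^ (p.+1 + slack))%N.
Proof.
apply: leq_trans (_ : p + slack <= _)%N; last first.
  by apply: leq_trans (ltnW (ltn_expl _ (isT : (1 < 2)%N))); rewrite addSn.
apply: leq_trans (passlen_plevel_le p).
apply: leq_trans (modulus_sqr_le_passlen _); rewrite /residual /=.
by case: ifP => // _; have := modulus_ge2 (plevel p); nia.
Qed.

Lemma cprod_residual_le n : (cprod residual n <= 2 ^ ((n + slack) ^ 2))%N.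
Proof.
elim: n => [|n IH]; first by rewrite cprod0 expn_gt0.
rewrite cprodS; apply: leq_trans (leq_mul IH (residual_le n)) _.
by rewrite -expnD leq_exp2l //; nia.
Qed.

Lemma run_start_free j y : (y < nruns (level j))%N -> (0 < position j y 0)%N ->
  ~~ special (position j y 0).-1.
Proof.
move=> yN s0; have h0 := halfrun_gt0 (level j).
case: y yN s0 => [|y] yN s0.
  case: j yN s0 h0 => [|j] yN s0 h0; first by rewrite /position start0 in s0.
  have N0 := nruns_gt0 (level j); have h1 := halfrun_gt0 (level j).
  have -> : (position j.+1 0 0).-1 =
      position j (nruns (level j)).-1 (2 * halfrun (level j)).-1.
    rewrite /position startS mul0n !addn0.
    have -> : passlen (level j) = (nruns (level j) * (2 * halfrun (level j)))%N by [].
    by nia.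
  by rewrite special_position; lia.
have -> : (position j y.+1 0).-1 = position j y (2 * halfrun (level j)).-1.
  by rewrite /position; nia.
by rewrite special_position; lia.
Qed.

(** The witness is the last position before the run containing [n]. A run starting at [s] has length
    at most [s + slack], so going back to its start at most halves the shifted index. *)
Lemma previous_free n : (slack <= n)%N ->
  exists p, [/\ ~~ special p, (p < n)%N & (n.+1 + slack <= 2 * (p.+1 + slack))%N].
Proof.
move=> sn; pose s := position (pass n) (run n) 0.
have nE := positionK n; have ol := offset_lt n.
have sE : (s + offset n = n)%N by rewrite /s positionD.
have l1 := halfrun_le_passlen (level (pass n)).
have l2 := passlen_level_le (pass n).
have l3 := start_ge (pass n).
have l4 : (start (pass n) <= s)%N by rewrite leq_addr.
have l5 : (n.+1 + slack <= 2 * (s + slack))%N by lia.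
have s0 : (0 < s)%N by lia.
exists s.-1; split; first exact: run_start_free (run_lt n) s0.
  by lia.
by rewrite prednK.
Qed.

Lemma leq_branching_cprod p n : (p < n)%N -> (branching p.+1 <= cprod branching n)%N.
Proof.
move=> pn; apply: leq_trans (cprod_le branching_gt0 pn).
by rewrite cprodS leq_pmull // cprod_gt0 // => i; exact: branching_gt0.
Qed.

(** The cube in the exponent of [branching] serves here: the residual product has only a square in
    its exponent, and a single free position at comparable distance already beats its [r]-th
    power. *)
Lemma residual_negligible r : exists n0, forall n, (n0 <= n)%N ->
  (cprod residual n.+1 ^ r <= cprod branching n)%N.
Proof.
exists (slack + 8 * r)%N => n nn.
have [p [Sp pn np]] := @previous_free n ltac:(lia).
apply: leq_trans (leq_branching_cprod pn); rewrite /branching /= (negbTE Sp).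
apply: leq_trans (_ : (2 ^ ((n.+1 + slack) ^ 2)) ^ r <= _)%N.
  by case: r nn => // r _; rewrite leq_exp2r ?cprod_residual_le.
rewrite -expnM leq_exp2l //.
have : (4 * r <= p.+1 + slack)%N by lia.
move: np; move: (p.+1 + slack)%N (n.+1 + slack)%N => t m mt rt.
apply: leq_trans (_ : (2 * t) ^ 2 * r <= _)%N; first by rewrite leq_mul2r leq_sqr mt orbT.
by rewrite expnS expnS !expnMn; nia.
Qed.

(** For [D <= branching n.+1] it yields [(D / cprod branching n.+1) ^ (r + 1) <= (D / cprod qseq
    n.+1) ^ r], the Hoelder bound with exponent [r / (r + 1)]. *)
Lemma qseq_branching_growth r : exists n0, forall n, (n0 <= n)%N ->
  (branching n.+1 * cprod qseq n.+1 ^ r <= cprod branching n.+1 ^ r.+1)%N.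
Proof.
have [n0 Hn0] := residual_negligible r; exists n0 => n /Hn0 h.
rewrite cprod_qseq expnMn expnSr mulnCA leq_mul2l; apply/orP; right.
by rewrite [cprod branching n.+1]cprodS mulnC leq_mul2r h orbT.
Qed.

Section Holder.
Variable R : realType.
Implicit Types (u : R).

Lemma floor_ltP (v w : R) : v + 1 <= w -> Num.floor v != Num.floor w.
Proof.
move=> vw; apply/negP => /eqP E.
have /andP[v1 v2] := floor_bounds v; have /andP[w1 w2] := floor_bounds w.
by rewrite -E in w2; lra.
Qed.

Lemma branching_floor_separates u u' : u < u' ->
  exists n, Num.floor ((cprod branching n)%:R * u)
            != Num.floor ((cprod branching n)%:R * u').
Proof.
move=> uu; pose t := (Num.truncn (u' - u)^-1).+1.
have [p tp Sp] := free_exists t; exists p.+1; apply: floor_ltP.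
have d0 : 0 < u' - u by rewrite subr_gt0.
rewrite -lerBrDl -mulrBr -ler_pdivrMr // mul1r.
apply: ltW; apply: lt_le_trans (truncnS_gt _) _; rewrite ler_nat -/t.
apply: leq_trans tp _; apply: leq_trans (leq_branching_cprod (ltnSn p)).
by apply: leq_trans (branching_free_ge Sp); rewrite addSn ltnW // ltnS leq_addr.
Qed.

(** At the first index where the scaled floors in base [branching] differ, the digits of [u] and
    [u'] differ by some [D]. This gives [u' - u] at most [D + 1] units. The corresponding digits of
    the points differ by [M * D], and [M * D - 1 >= D] as [M >= 2]. *)
Lemma cantor_point_separation u u' : 0 <= u -> u < u' -> u' < 1 ->
  exists n D, [/\ (0 < D <= branching n.+1)%N,
    u' - u <= 2 * D%:R / (cprod branching n.+1)%:R &
    D%:R / (cprod qseq n.+1)%:R <= cantor_point u' - cantor_point u].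
Proof.
move=> u0 uu u1; have sep := branching_floor_separates uu.
case: (ex_minnP sep) => -[|n] fn min.
  have f0 (v : R) : 0 <= v -> v < 1 -> Num.floor ((cprod branching 0)%:R * v) = 0.
    by move=> v0 v1; rewrite cprod0 mul1r; apply: floor_unique; rewrite ?add0r.
  by rewrite !f0 ?eqxx // in fn; lra.
have eqf i : (i <= n)%N -> Num.floor ((cprod branching i)%:R * u) =
    Num.floor ((cprod branching i)%:R * u').
  by move=> ni; apply/eqP; apply: contraTT isT => /min; rewrite leqNgt ltnS ni.
have eqd i : (i <= n)%N -> cdigit branching u i = cdigit branching u' i.
  by move=> ni; rewrite /cdigit eqf.
have eqX : cnum qseq (pdigit u) n = cnum qseq (pdigit u') n.
  have : (n <= n)%N by []; elim: {-2}n => [//|i IH ni] /=.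
  by rewrite IH ?(ltnW ni) // /pdigit eqd.
have f1 := floor_cprodS u (branching_gt0 n.+1).
have f2 := floor_cprodS u' (branching_gt0 n.+1).
have Pk0 : (0 : R) < (cprod branching n.+1)%:R.
  by rewrite ltr0n cprod_gt0 // => i; exact: branching_gt0.
have P0 : (0 : R) < (cprod qseq n.+1)%:R.
  by rewrite ltr0n cprod_gt0 // => i; exact: qseq_gt0.
have lef : Num.floor ((cprod branching n.+1)%:R * u) <=
           Num.floor ((cprod branching n.+1)%:R * u').
  by apply: le_floor; rewrite ler_pM2l // ltW.
have tlt : (cdigit branching u n.+1 < cdigit branching u' n.+1)%N.
  move: fn lef; rewrite f1 f2 eqf // lerD2l (inj_eq (addrI _)) lez_nat eqz_nat.
  by move=> ne le; rewrite ltn_neqAle ne le.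
(* On a special position [branching] is 1, so both digits would be 0. *)
have Sn : ~~ special n.
  apply/negP => Sn; have := cdigit_lt u' (branching_gt0 n.+1).
  by rewrite /branching /= Sn ltnS leqn0 => /eqP E; rewrite /branching E in tlt.
exists n, (cdigit branching u' n.+1 - cdigit branching u n.+1)%N; split.
- rewrite subn_gt0 tlt /= (leq_trans (leq_subr _ _)) // ltnW //.
  exact: cdigit_lt (branching_gt0 _).
- have /andP[b1 b2] := floor_bounds ((cprod branching n.+1)%:R * u).
  have /andP[b3 b4] := floor_bounds ((cprod branching n.+1)%:R * u').
  rewrite ler_pdivlMr // mulrC mulrBr.
  have D1 : 1 <= (cdigit branching u' n.+1 - cdigit branching u n.+1)%N%:R :> R.
    by rewrite ler1n subn_gt0.
  move: b1 b4; rewrite f1 f2 eqf // !intrD -!pmulrn.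
  move: D1; rewrite natrB; last exact: ltnW.
  lra.
have /andP[c1 c2] := point_bounds u n.+1.
have /andP[c3 c4] := point_bounds u' n.+1.
rewrite ler_pdivrMr // mulrC mulrBr.
move: c2 c3; rewrite [cnum _ _ _]/= [cnum _ (pdigit u') _]/= eqX !pdigit_free //.
move: tlt (modulus_ge2 (plevel n)).
move: ((cprod qseq n.+1)%:R * cantor_point u) ((cprod qseq n.+1)%:R * cantor_point u').
move: (cdigit branching u' n.+1) (cdigit branching u n.+1) (modulus (plevel n)).
move: (cnum qseq (pdigit u') n * qseq n.+1)%N => Z t' t M A A' tt' M2.
rewrite !natrD !natrM -!natr1 natrB; last exact: ltnW.
have D1 : 1 <= t'%:R - t%:R :> R by rewrite lerBrDl natr1 ler_nat.
have : 0 <= (M%:R - 2) * (t'%:R - t%:R) :> R.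
  by apply: mulr_ge0; [rewrite subr_ge0 ler_nat|lra].
lra.
Qed.

Lemma cantor_point_holder (s : R) : 0 <= s -> s < 1 ->
  exists2 C : R, 0 < C & forall u u', 0 <= u < 1 -> 0 <= u' < 1 ->
    `|u - u'| <= C * `|cantor_point u - cantor_point u'| `^ s.
Proof.
move=> s0 s1.
(* Any [r] above [s / (1 - s)] satisfies [s <= r / (r + 1)]. *)
pose r := (Num.truncn (s / (1 - s))).+1.
have sr : s * r.+1%:R <= r%:R.
  have : s / (1 - s) < r%:R by apply: truncnS_gt.
  rewrite ltr_pdivrMr; last by lra.
  by rewrite -[r.+1%:R]natr1; lra.
have [n0 Hn0] := qseq_branching_growth r.
have P0 n : (0 : R) < (cprod qseq n)%:R.
  by rewrite ltr0n cprod_gt0 // => i; exact: qseq_gt0.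
have K0 n : (0 : R) < (cprod branching n)%:R.
  by rewrite ltr0n cprod_gt0 // => i; exact: branching_gt0.
(* The 2 comes from [cantor_point_separation]; the product covers pairs separating before [n0],
   whose images are at least its inverse apart. *)
pose C : R := 2 * (cprod qseq n0)%:R.
have C2 : 2 <= C.
  by rewrite /C ler_peMr // ler1n cprod_gt0 // => i; exact: qseq_gt0.
have lt_case u u' : 0 <= u -> u < u' -> u' < 1 ->
    u' - u <= C * `|cantor_point u' - cantor_point u| `^ s.
  move=> u0 uu u1; have [n [D [/andP[D0 DK] ub xb]]] := cantor_point_separation u0 uu u1.
  have /andP[x0 x1] := point_itv u; have /andP[x0' x1'] := point_itv u'.
  set f : R := D%:R / (cprod qseq n.+1)%:R in xb.
  have D0R : (0 : R) < D%:R by rewrite ltr0n.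
  have f0 : 0 < f by rewrite divr_gt0.
  set g : R := cantor_point u' - cantor_point u in xb *.
  have g1 : g <= 1 by rewrite /g; lra.
  have f1 : f <= 1 by apply: le_trans xb g1.
  have g0 : 0 < g by apply: lt_le_trans xb.
  have gs0 : 0 <= g `^ s by exact: powR_ge0.
  rewrite (gtr0_norm g0).
  case: (ltnP n n0) => nn.
    have : (cprod qseq n0)%:R^-1 <= g `^ s.
      apply: le_trans (_ : g <= _); last by apply: ger1_powR; [rewrite g0|exact: ltW].
      apply: le_trans xb; rewrite /f -[leLHS]mul1r; apply: ler_pM => //.
      - by rewrite ler1n.
      - by rewrite lef_pV2 ?posrE // ler_nat cprod_le // => i; exact: qseq_gt0.
    rewrite -(ler_pM2l (P0 n0)) mulfV ?gt_eqF // => h.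
    rewrite /C -mulrA; lra.
  have XE : (D%:R / (cprod branching n.+1)%:R) ^+ r.+1 <= f ^+ r.
    rewrite /f !expr_div_n ler_pdivrMr ?exprn_gt0 // mulrAC ler_pdivlMr ?exprn_gt0 //.
    rewrite exprS -!natrX -!natrM ler_nat.
    rewrite mulnAC [leqRHS]mulnC leq_mul2r; apply/orP; right.
    by apply: leq_trans (Hn0 _ nn); rewrite leq_mul2r DK orbT.
  have : D%:R / (cprod branching n.+1)%:R <= f `^ s.
    rewrite -(@ler_pXn2r _ r.+1) ?nnegrE ?powR_ge0 ?divr_ge0 //.
    apply: le_trans XE _; rewrite -(powR_mulrn r (ltW f0)).
    rewrite -(powR_mulrn r.+1 (powR_ge0 _ _)) -powRrM.
    by apply: ger_powR => //; rewrite f0.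
  have : f `^ s <= g `^ s by apply: ge0_ler_powR => //; rewrite nnegrE ltW.
  move: ub; rewrite -mulrA => ub h1 h2.
  by apply: le_trans ub _; apply: ler_pM => //; exact: le_trans h2 h1.
exists C; first by lra.
move=> u u' /andP[u0 u1] /andP[u0' u1'].
case: (ltgtP u u') => uu; last first.
- by rewrite uu subrr normr0 mulr_ge0 ?powR_ge0 //; lra.
- by rewrite gtr0_norm ?subr_gt0 //; exact: lt_case.
by rewrite distrC [X in X `^ _]distrC gtr0_norm ?subr_gt0 //; exact: lt_case.
Qed.

End Holder.

(** * Hausdorff dimension *)

Section Dimension.
Variable R : realType.
Local Open Scope ereal_scope.

Lemma diameter_ge (A : set R) (x y : R) : A x -> A y -> `|x - y|%:E <= diameter A.
Proof. by move=> Ax Ay; apply: ereal_sup_ubound; exists (x, y). Qed.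

Lemma diameter_le (A : set R) (d : R) :
  (forall x y, A x -> A y -> (`|x - y| <= d)%R) -> diameter A <= d%:E.
Proof.
by move=> Ad; apply: ge_ereal_sup => _ [[x y] /= [Ax Ay] <-]; rewrite lee_fin Ad.
Qed.

Lemma diam_pow_ge0 (s : R) (A : set R) : 0 <= diam_pow s A.
Proof. by rewrite /diam_pow; case: pselect => //= H; exact: poweR_ge0. Qed.

Lemma diam_pow_powR (s : R) (A : set R) (x : R) : A x -> diameter A <= 1 ->
  exists2 d : R, (0 <= d)%R & diameter A = d%:E /\ diam_pow s A = (d `^ s)%:E.
Proof.
move=> Ax dA.
have d0 : 0 <= diameter A by have := diameter_ge Ax Ax; rewrite subrr normr0.
have df : diameter A \is a fin_num.
  by rewrite ge0_fin_numE // (le_lt_trans dA) // ltry.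
exists (fine (diameter A)); first exact: fine_ge0.
rewrite fineK // /diam_pow; split => //.
case: pselect => [A0|A0] /=; first by rewrite A0 in Ax.
by rewrite -{1}(fineK df) poweR_EFin.
Qed.

Lemma unit_interval_cover (I : nat -> set R) :
  (forall i, measurable (I i)) -> (`[0%R, 1%R[%classic `<=` \bigcup_i I i) ->
  1 <= \sum_(0 <= i <oo) lebesgue_measure (I i).
Proof.
move=> mI cov.
have -> : 1 = lebesgue_measure (`[0%R, 1%R[%classic : set R).
  by rewrite lebesgue_measure_itv /= lte_fin ltr01 sube0.
by apply: measure_sigma_subadditive.
Qed.

(** By the Hoelder bound the parameters of points in [F i] lie in an interval of length at most
    [2 * C] times the weight of [F i]. These intervals cover [[0, 1)], so their lengths sum to at
    least 1. *)
Lemma hausdorff_content_gt0 (s : R) : (0 <= s)%R -> (s < 1)%R ->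
  exists2 c : R, (0 < c)%R & c%:E <= hausdorff_content s 1 (@U_set R qseq).
Proof.
move=> s0 s1; have [C C0 HC] := cantor_point_holder s0 s1.
exists (2 * C)^-1%R; first by rewrite invr_gt0 mulr_gt0.
apply: le_ereal_inf_tmp => _ [F [cov dF] <-].
pose good i (u0 : R) := (0 <= u0 < 1)%R /\ F i (cantor_point u0).
(* A centre for each [F i]: a parameter of one of its points if there is any, and the default 0
   otherwise, where the interval is taken empty. *)
have ex i : exists v, forall u, good i u -> good i v.
  have [[u gu]|no] := pselect (exists u, good i u); first by exists u.
  by exists 0%R => u gu; exfalso; apply: no; exists u.
have [u0 Hu0] := choice ex.
pose r i := (C * fine (diam_pow s (F i)))%R.
pose I i : set R := if pselect (good i (u0 i))
  then `[(u0 i - r i)%R, (u0 i + r i)%R]%classic else set0.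
have mI i : measurable (I i).
  by rewrite /I; case: pselect => H /=; [exact: measurable_itv|exact: measurable0].
have covI : `[0%R, 1%R[%classic `<=` \bigcup_i I i.
  move=> u /=; rewrite in_itv /= => u01.
  have [i _ Fi] := cov _ (point_in_U u); exists i => //.
  have gu : good i u by [].
  rewrite /I; case: pselect => [[u01' Fi']|h]; last by exfalso; apply: h; apply: Hu0 gu.
  have [d d0 [dE dp]] := diam_pow_powR s Fi (dF i).
  rewrite /= in_itv /= -ler_distl /r dp /=.
  apply: le_trans (HC _ _ u01 u01') _; rewrite ler_pM2l //.
  apply: ge0_ler_powR => //; rewrite ?nnegrE //.
  by have := diameter_ge Fi Fi'; rewrite dE lee_fin.
have lI i : lebesgue_measure (I i) <= (2 * C)%:E * diam_pow s (F i).
  rewrite /I; case: pselect => [[u01' Fi']|h] /=; last first.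
    by rewrite measure0 mule_ge0 ?diam_pow_ge0 // lee_fin mulr_ge0 // ltW.
  have [d d0 [dE dp]] := diam_pow_powR s Fi' (dF i).
  rewrite lebesgue_measure_itv /= /r dp /=; case: ifP => _; last first.
    by rewrite -EFinM lee_fin mulr_ge0 ?powR_ge0 // mulr_ge0 // ltW.
  by rewrite -EFinB -EFinM lee_fin; lra.
have := le_trans (unit_interval_cover mI covI)
  (lee_nneseries (fun i _ _ => measure_ge0 lebesgue_measure (I i)) (fun i _ => lI i)).
rewrite nneseriesZl; last by move=> i _; exact: diam_pow_ge0.
move=> h; rewrite -(@lee_pmul2l _ (2 * C)%:E) ?lte_fin ?mulr_gt0 //.
by rewrite -EFinM mulfV // gt_eqF // mulr_gt0.
Qed.

Lemma hausdorff_dim_ge1 : 1 <= hausdorff_dim (@U_set R qseq).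
Proof.
apply: le_ereal_inf_tmp => _ [s [s0 Hs] <-]; rewrite lee_fin leNgt.
apply/negP => s1; have [c c0 Hc] := hausdorff_content_gt0 s0 s1.
have : hausdorff_content s 1 (@U_set R qseq) <= hausdorff_measure s (@U_set R qseq).
  by apply: ereal_sup_ubound; exists 1%R => //=.
by rewrite Hs => /(le_trans Hc); rewrite lee_fin leNgt c0.
Qed.

(** * Upper bound for the dimension by uniform grids *)

Lemma hausdorff_content_le_grid (s delta : R) (n : nat) (A : set R) :
  (0 <= s)%R -> A `<=` `[0%R, 1%R[%classic -> (0 < n)%N -> (n%:R^-1 <= delta)%R ->
  hausdorff_content s delta A <= (n%:R * n%:R^-1 `^ s)%:E.
Proof.
move=> s0 A01 n0 nd; have nR : (0 < n%:R :> R)%R by rewrite ltr0n.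
pose F i : set R := if (i < n)%N
  then [set x | (i%:R <= n%:R * x < i%:R + 1)%R] else set0.
have dF i : (i < n)%N -> diameter (F i) <= n%:R^-1%:E.
  move=> ni; apply: diameter_le => x y; rewrite /F ni /= => /andP[x1 x2] /andP[y1 y2].
  rewrite -[leRHS]mul1r ler_pdivlMr // -(gtr0_norm nR) -normrM mulrC mulrBr.
  by rewrite ler_norml; lra.
have dF0 i : (n <= i)%N -> F i = set0 by rewrite /F leqNgt => /negbTE->.
apply: le_trans (_ : \sum_(0 <= i <oo) diam_pow s (F i) <= _).
  apply: ereal_inf_lbound; exists F => //; split=> [x /A01|i].
    rewrite /= in_itv /= => /andP[x0 x1].
    have /andP[f1 f2] := floor_bounds (n%:R * x).
    have f0 : (0 <= Num.floor (n%:R * x))%R by rewrite floor_ge0 mulr_ge0.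
    have fE : Num.floor (n%:R * x) = `|Num.floor (n%:R * x)|%N by rewrite gez0_abs.
    exists `|Num.floor (n%:R * x)|%N => //.
    have fn : (`|Num.floor (n%:R * x)| < n)%N.
      have : (Num.floor (n%:R * x) < n%:Z)%R.
        by rewrite floor_lt_int -pmulrn gtr_pMr.
      by rewrite fE ltz_nat.
    by rewrite /F fn /= pmulrn -fE f1.
  case: (ltnP i n) => ni; first by rewrite (le_trans (dF _ ni)) // lee_fin.
  by rewrite dF0 // /diameter setX0 image_set0 ereal_sup0 leNye.
have dp0 i : (n <= i)%N -> diam_pow s (F i) = 0.
  by move=> /dF0 ->; rewrite /diam_pow; case: pselect => h //=; exfalso; apply: h.
have dpn i : (i < n)%N -> diam_pow s (F i) <= (n%:R^-1 `^ s)%:E.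
  move=> ni; rewrite /diam_pow; case: pselect => [h|Fn] /=.
    by rewrite lee_fin powR_ge0.
  have [x Fx] : F i !=set0 by apply/set0P/eqP.
  have d0 : 0 <= diameter (F i) by have := diameter_ge Fx Fx; rewrite subrr normr0.
  rewrite -poweR_EFin gt0_ler_poweR ?in_itv /= ?leey ?andbT ?dF //.
rewrite (@nneseries_split _ _ 0 n); last by move=> k _; exact: diam_pow_ge0.
rewrite add0n eseries0 ?adde0; last by move=> i ni _; exact: dp0.
rewrite big_nat; apply: le_trans (lee_sum _ (fun i h => dpn i (andP h).2)) _.
by rewrite -big_nat sumEFin lee_fin sumr_cst_nat subn0.
Qed.

Lemma hausdorff_measure_unit (s : R) (A : set R) : (1 < s)%R ->
  A `<=` `[0%R, 1%R[%classic -> hausdorff_measure s A = 0.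
Proof.
move=> s1 A01; have s0 : (0 <= s)%R by lra.
have H delta : (0 < delta)%R -> hausdorff_content s delta A = 0.
  move=> d0; apply/eqP; rewrite eq_le; apply/andP; split; last first.
    apply: le_ereal_inf_tmp => _ [F _ <-].
    by apply: nneseries_ge0 => i _ _; exact: diam_pow_ge0.
  apply/lee_addgt0Pr => e e0; rewrite add0e.
  (* The first term brings the mesh [1 / n] below [delta], the second brings [n ^ (1 - s)] below
     [e]. *)
  pose t : R := (Num.max delta^-1 (e^-1 `^ (s - 1)^-1))%R.
  pose n := (Num.truncn t).+1.
  have nt : (t < n%:R)%R by exact: truncnS_gt.
  have n0 : (0 < n%:R :> R)%R by rewrite ltr0n.
  move: nt; rewrite gt_max => /andP[nd ne].
  apply: le_trans (@hausdorff_content_le_grid s delta n A s0 A01 (ltn0Sn _) _) _.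
    by rewrite invf_ple ?posrE // ltW.
  rewrite lee_fin.
  have -> : (n%:R * n%:R^-1 `^ s = (n%:R `^ (s - 1))^-1 :> R)%R.
    have nn0 : n%:R != 0%R :> R by rewrite gt_eqF.
    rewrite -powR_inv1 ?ler0n // -powRrM mulN1r -powRN opprB.
    rewrite powRD ?nn0 ?implybT // powRr1 //.
  rewrite invf_ple ?posrE ?powR_gt0 //.
  have -> : (e^-1 = (e^-1 `^ (s - 1)^-1) `^ (s - 1))%R.
    by rewrite -powRrM mulVf ?powRr1 ?invr_ge0 ?ltW // subr_eq0 gt_eqF.
  apply: ge0_ler_powR; rewrite ?nnegrE ?powR_ge0 ?subr_ge0 ?ltW //.
rewrite /hausdorff_measure; apply/eqP; rewrite eq_le; apply/andP; split.
  by apply: ge_ereal_sup => _ [delta d0 <-]; rewrite H.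
by apply: ereal_sup_ubound; exists 1%R => //=; rewrite H.
Qed.

Lemma hausdorff_dim_le1 : hausdorff_dim (@U_set R qseq) <= 1.
Proof.
apply/lee_addgt0Pr => e e0; rewrite -EFinD.
apply: ereal_inf_lbound; exists (1 + e)%R => //; split; first by lra.
apply: hausdorff_measure_unit; first by lra.
move=> x [[E [E0 _ _ _]] _].
have /andP[h1 h2] := floor_bounds x.
by rewrite -E0 in h1 h2; rewrite /= in_itv /= h1 -[1%R]add0r.
Qed.

End Dimension.

Theorem mainTheorem1 (R : realType) :
  exists q : nat -> nat,
    basic_sequence q /\ hausdorff_dim (@U_set R q) = 1%E.
Proof.
exists qseq; split; first by move=> n _; exact: qseq_ge2.
by apply/eqP; rewrite eq_le hausdorff_dim_le1 hausdorff_dim_ge1.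
Qed.
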